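(* Let $A=(A(i,j),\,0\le i,j\le n-1)$ be an irreducible, aperiodic $0$-$1$ matrix, let $\Sigma_A$ be the associated two-sided shift of finite type, let $\phi\colon\Sigma_A\to\mathbb{R}$ be a function with summable variation, and let $\mathcal{G}$ be a countable, discrete group with finite conjugacy classes. For every continuous map $\psi\colon\Sigma_A\to\mathcal{G}$ the Gibbs measure $\mu_\phi$ is ergodic under the equivalence relation $$S_A^\psi=\{(x,x')\in R_A:\ \mathcal{J}_+^\psi(x,x')=\mathcal{J}_-^\psi(x,x')\}.$$
   Context: $\Sigma_A=\{x=(x_k)\in\{0,\dots,n-1\}^{\mathbb{Z}}: A(x_k,x_{k+1})=1\ \forall k\in\mathbb{Z}\}$ with the (restricted) product topology, and $\sigma$ is the shift, $\sigma(x)_k=x_{k+1}$. The Gibbs relation is $R_A=\{(x,x')\in\Sigma_A\times\Sigma_A: x_k\ne x'_k\text{ for only finitely many }k\in\mathbb{Z}\}$. For a Borel equivalence relation $R$ with countable classes on a standard Borel space $X$, the saturation of $B\subset X$ is $R(B)=\{x'\in X:(x,x')\in R\text{ for some }x\in B\}$. A $\sigma$-finite Borel measure $\mu$ is quasi-invariant under $R$ if $\mu(R(B))=0$ for every Borel $B$ with $\mu(B)=0$; it is ergodic under $R$ if it is quasi-invariant and for every Borel $B$ either $\mu(R(B))=0$ or $\mu(X\smallsetminus R(B))=0$. If $\mu$ is a probability measure quasi-invariant under $R$, its Radon-Nikodym derivative is a Borel map $\rho_\mu\colon R\to(0,\infty)$ with $\rho_\mu(x,x')\rho_\mu(x',x'')=\rho_\mu(x,x'')$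 and $\rho_\mu(Wx,x)=\frac{d\mu W}{d\mu}(x)$ for $\mu$-a.e. $x$, for every Borel automorphism $W$ of $X$ with $(x,Wx)\in R$ for all $x$. For continuous $\phi\colon\Sigma_A\to\mathbb{R}$ put $\omega_0(\phi)=\max\{|\phi(x)-\phi(x')|:x,x'\in\Sigma_A\}$ and $\omega_k(\phi)=\max\{|\phi(x)-\phi(x')|: x_l=x'_l\text{ for }|l|<k\}$ for $k\ge1$; $\phi$ has summable variation if $\sum_{k\ge0}\omega_k(\phi)<\infty$. A Borel probability measure $\mu$ on $\Sigma_A$ is a Gibbs measure of $\phi$ if it is quasi-invariant under $R_A$ and $\log\rho_\mu(x,x')=\sum_{k\in\mathbb{Z}}(\phi(\sigma^k x)-\phi(\sigma^k x'))$ for all $(x,x')\in R_A$ outside $N\times N$ for some $\mu$-null set $N$. It is known that for $A$ irreducible and aperiodic and $\phi$ of summable variation there is exactly one Gibbs measure of $\phi$; it is denoted $\mu_\phi$. ''Finite conjugacy classes'' means $|\{hgh^{-1}:h\in\mathcal{G}\}|<\infty$ for every $g\in\mathcal{G}$. For continuous $\psi\colon\Sigma_A\to\mathcal{G}$ and $(x,x')\in R_A$, $$\mathcal{J}_+^\psi(x,x')=\lim_{K\to\infty}\psi(x)\psi(\sigma x)\cdots\psi(\sigma^K x)\,\bigl(\psi(x')\psi(\sigma x')\cdots\psi(\sigma^K x')\bigr)^{-1},$$ $$\mathcal{J}_-^\psi(x,x')=\lim_{K\to\infty}\bigl(\psi(\sigma^{-K}x)\cdots\psi(\sigma^{-1}x)\bigr)^{-1}\,\psi(\sigma^{-K}x')\cdots\psi(\sigma^{-1}x');$$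 the expressions are eventually constant in $K$, so the limits exist. $S_A^\psi$ is an equivalence relation contained in $R_A$. *)

(* Defs.v *)
From HB Require Import structures.
From mathcomp Require Import all_boot all_order all_algebra.
From mathcomp Require Import all_classical all_reals all_analysis.
Import Order.TTheory GRing.Theory Num.Theory.
Import numFieldNormedType.Exports.

Set Implicit Arguments.
Unset Strict Implicit.
Unset Printing Implicit Defensive.

Local Open Scope classical_set_scope.
Local Open Scope ring_scope.

Definition zero_one n (A : 'M[nat]_n) : Prop :=
  forall i j, A i j = 0%N \/ A i j = 1%N.

Definition irreducible n (A : 'M[nat]_n) : Prop :=
  forall i j, exists2 m : nat, (0 < m)%N & (0 < (A ^+ m) i j)%N.

(* Every state has period 1: the greatest common divisor of its return times
   is 1. *)
Definition aperiodic n (A : 'M[nat]_n) : Prop :=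
  forall (i : 'I_n) (d : nat),
    (forall m : nat, (0 < m)%N -> (0 < (A ^+ m) i i)%N -> (d %| m)%N) ->
    d = 1%N.

Definition sft n (A : 'M[nat]_n) :
    set (prod_topology (fun _ : int => discrete_topology 'I_n)) :=
  [set x | forall k : int, A (x k) (x (k + 1)) = 1%N].

Lemma path_of_mxpow n (A : 'M[nat]_n) (m : nat) i j : (0 < (A ^+ m) i j)%N ->
  exists p : nat -> 'I_n, [/\ p 0%N = i, p m = j &
    forall k, (k < m)%N -> (0 < A (p k) (p k.+1))%N].
Proof.
elim: m i j => [|m IHm] i j.
  rewrite expr0 mxE; case: eqP => [-> _|//]; by exists (fun=> j).
rewrite exprS mxE lt0n; rewrite sum_nat_eq0.
rewrite negb_forall => /existsP[l] /=.
rewrite -lt0n muln_gt0 => /andP[Ail /IHm[p [p0 pm pP]]].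
exists (fun k => if k is k'.+1 then p k' else i); split => // -[_|k].
  by rewrite p0.
by rewrite ltnS => /pP.
Qed.

Lemma sft_neq0 n (A : 'M[nat]_n) :
  (0 < n)%N -> zero_one A -> irreducible A -> sft A !=set0.
Proof.
move=> n_gt0 A01 /(_ (Ordinal n_gt0) (Ordinal n_gt0))[m m_gt0].
move=> /path_of_mxpow[p [p0 pm pP]].
have A1 i j : (0 < A i j)%N -> A i j = 1%N by case: (A01 i j) => ->.
have m0 : m%:Z != 0 by rewrite eqz_nat -lt0n.
pose r (k : int) := `|(k %% m)%Z|%N.
have rE k : (r k)%:Z = (k %% m)%Z by rewrite gez0_abs // modz_ge0.
have r_lt k : (r k < m)%N by rewrite -ltz_nat rE ltz_pmod.
exists (fun k => p (r k)) => k; apply: A1.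
suff -> : p (r (k + 1)) = p (r k).+1 by exact: pP.
have rS : (r (k + 1))%:Z = (((r k).+1)%:Z %% m)%Z.
  by rewrite rE -addn1 PoszD rE modzDml.
have [rkm|] := ltnP (r k).+1 m.
  by congr p; apply/eqP; rewrite -eqz_nat rS modz_small.
rewrite leq_eqVlt ltnNge r_lt orbF => /eqP rkm.
by move: rS; rewrite -rkm modzz => -[->]; rewrite p0 pm.
Qed.

Definition SFT n (A : 'M[nat]_n) (A0 : sft A !=set0) : Type :=
  set_type (sft A).

(* The witness A0 is used only to provide the default point that
   pointedType, hence measurableType, asks for. *)
Definition sft_point n (A : 'M[nat]_n) (A0 : sft A !=set0) : SFT A0 :=
  exist _ (projT1 (cid A0)) (mem_set (projT2 (cid A0))).

HB.instance Definition _ n (A : 'M[nat]_n) (A0 : sft A !=set0) :=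
  Topological.copy (SFT A0) (set_type (sft A)).
HB.instance Definition _ n (A : 'M[nat]_n) (A0 : sft A !=set0) :=
  isPointed.Build (SFT A0) (sft_point A0).
HB.instance Definition _ n (A : 'M[nat]_n) (A0 : sft A !=set0) :=
  Measurable.copy (SFT A0) (g_sigma_algebraType (@open (SFT A0))).

Section shift.
Context n (A : 'M[nat]_n) (A0 : sft A !=set0).
Implicit Types x : SFT A0.

Definition letter x (k : int) : 'I_n := set_val x k.

Lemma shift_subproof (m : int) x :
  (fun k => letter x (k + m)) \in sft A.
Proof.
have /set_mem xA := valP x.
by apply/mem_set => k; rewrite addrAC; exact: xA.
Qed.

(* The power sigma^m of the shift, (sigma^m x)_k = x_(k + m). *)
Definition sft_shift (m : int) x : SFT A0 :=
  exist (fun y => y \in sft A) _ (shift_subproof m x).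

Lemma letter_shift m x k : letter (sft_shift m x) k = letter x (k + m).
Proof. by []. Qed.

Lemma shift_iter (m : nat) x : iter m (sft_shift 1) x = sft_shift m%:Z x.
Proof.
have letter_inj y z : letter y =1 letter z -> y = z.
  by move=> yz; apply: val_inj; apply/funext.
apply: letter_inj => k; elim: m k => [|m IHm] k.
  by rewrite letter_shift addr0.
by rewrite iterS letter_shift IHm !letter_shift -addrA intS.
Qed.

End shift.

Section relations.
Local Open Scope charge_scope.
Context d (X : measurableType d) (R : realType).
Implicit Types (S : set (X * X))
  (mu : {sigma_finite_measure set X -> \bar R}).

(* When S is a Borel equivalence relation with countable classes, the
   saturation of a Borel set is Borel, so that its measure makes sense. *)
Definition saturation S (B : set X) : set X :=
  [set x' | exists2 x, B x & S (x, x')].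

Definition quasi_invariant mu S : Prop :=
  forall B, measurable B -> mu B = 0%E -> mu (saturation S B) = 0%E.

Definition ergodic mu S : Prop :=
  quasi_invariant mu S /\
  forall B, measurable B ->
    mu (saturation S B) = 0%E \/ mu (~` saturation S B) = 0%E.

(* The pairs (W, V) range over the Borel automorphisms W, with V = W^-1; the
   measure mu W : B |-> mu (W B) is then the distribution of V under mu. *)
Definition is_radon_nikodym (mu : probability X R) S (rho : X * X -> R) :
    Prop :=
  [/\ measurable_fun S rho,
      forall z, S z -> 0 < rho z,
      forall x x' x'', S (x, x') -> S (x', x'') ->
        rho (x, x') * rho (x', x'') = rho (x, x'') &
      forall W V : {mfun X >-> X}, cancel W V -> cancel V W ->
        (forall x, S (x, W x)) ->
        {ae mu, forall x, (rho (W x, x))%:E =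
          ('d (charge_of_finite_measure (distribution mu V)) '/d mu) x}].

End relations.

Section gibbs.
Context n (A : 'M[nat]_n) (A0 : sft A !=set0) (R : realType).
Implicit Types (phi : SFT A0 -> R) (x : SFT A0).

Definition gibbs_relation : set (SFT A0 * SFT A0) :=
  [set z | finite_set [set k | letter z.1 k <> letter z.2 k]].

(* omega_k(phi); for k = 0 the constraint on (x, x') is void, so that this is
   the oscillation of phi. The maximum exists when phi is continuous. *)
Definition omega phi (k : nat) : R :=
  sup [set r | exists x x' : SFT A0,
    (forall l : int, (`|l| < k)%N -> letter x l = letter x' l) /\
    r = `|phi x - phi x'|].

Definition summable_variation phi : Prop :=
  (\sum_(0 <= k <oo) (omega phi k)%:E < +oo)%E.

(* The sum over all k in Z, as the sum over k >= 0 plus the sum over k < 0. *)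
Definition sum_int (u : int -> R) : R :=
  limn (series (fun k => u k%:Z)) + limn (series (fun k => u (- k.+1%:Z))).

Definition gibbs_measure phi (mu : probability (SFT A0) R) : Prop :=
  quasi_invariant mu gibbs_relation /\
  exists2 rho : SFT A0 * SFT A0 -> R,
    is_radon_nikodym mu gibbs_relation rho &
    exists2 N : set (SFT A0), measurable N /\ mu N = 0%E &
      forall x x', gibbs_relation (x, x') -> ~ (N `*` N) (x, x') ->
        ln (rho (x, x')) =
        sum_int (fun k => phi (sft_shift k x) - phi (sft_shift k x')).

End gibbs.

Section cocycle.
Context n (A : 'M[nat]_n) (A0 : sft A !=set0) (G : groupType).
Variable psi : SFT A0 -> G.
Implicit Types x : SFT A0.
Local Open Scope group_scope.

(* The limit of u in the discrete topology, and 1 if u does not converge. *)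
Definition discrete_lim (u : nat -> G) : G :=
  xget 1 [set g : G | u @ \oo --> (g : discrete_topology G)].

(* psi(x) psi(sigma x) ... psi(sigma^K x) *)
Definition forward_prod (K : nat) x : G :=
  \prod_(k < K.+1) psi (sft_shift k%:Z x).

(* psi(sigma^-K x) ... psi(sigma^-1 x) *)
Definition backward_prod (K : nat) x : G :=
  \prod_(k < K) psi (sft_shift (k%:Z - K%:Z)%R x).

Definition J_plus x x' : G :=
  discrete_lim (fun K => forward_prod K x * (forward_prod K x')^-1).

Definition J_minus x x' : G :=
  discrete_lim (fun K => (backward_prod K x)^-1 * backward_prod K x').

Definition S_relation : set (SFT A0 * SFT A0) :=
  [set z | gibbs_relation z /\ J_plus z.1 z.2 = J_minus z.1 z.2].

End cocycle.

Definition finite_conjugacy_classes (G : groupType) : Prop :=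
  forall g : G, finite_set [set (h * g * h^-1)%g | h in [set: G]].

(* Main.v *)
(* An exchange [swap a w w'] of two words at position [a] changes the measure by a
   factor [expR (energy phi (swap a w w' x) x)], and summable variation bounds the
   energy uniformly in [a]. Two consequences:
   - Invariant sets are quasi-independent of all cylinders, uniformly, and hence
     have measure 0 or 1: this is ergodicity under the Gibbs relation.
   - Far away exchanges hardly move any Borel set [B].

   Two points are [S_relation]-equivalent iff they differ at finitely many places
   and the products of [psi] along all large windows agree. Replacing a word [u] by
   [u'] at position [b] multiplies that product by [alpha * twist * alpha^-1],
   where [alpha] is the product to the left of [b] and [twist] depends on the words
   only. Doing the same at [b + t] gives an [S_relation]-equivalent point whenever
   the product of [psi] from [b] to [b + t] commutes with [twist]. Since [twist] has
   finitely many conjugates such a [t] can be produced by changing boundedly many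
   coordinates, so by the energy bound infinitely many [t] occur for almost all
   points that carry [u] at [b]. So if [B] is saturated, the exchange at [b]
   preserves [B] exactly when exchanges far away do, and therefore it preserves
   [B] up to a null set. Hence saturated sets are invariant under the Gibbs
   relation up to null sets. *)
From HB Require Import structures.
Require Import Defs.
From mathcomp Require Import all_boot all_order all_algebra.
From mathcomp Require Import zify ring lra.
From mathcomp Require Import all_classical all_reals all_analysis.
Import Order.TTheory GRing.Theory Num.Theory.
Import numFieldNormedType.Exports.

Set Implicit Arguments.
Unset Strict Implicit.
Unset Printing Implicit Defensive.

Local Open Scope classical_set_scope.
Local Open Scope ring_scope.

(** * Points of the shift *)

(** Let [d] be the least positive difference of two elements of [P]. Euclidean division shows that
    [d] divides every element, so [d = 1]; for [b > 0], consecutive elements [b] and [b + 1]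
    generate everything from [b * b] on. *)
Lemma semigroup_cofinite (P : nat -> Prop) :
  (forall a b, P a -> P b -> P (a + b)%N) ->
  (forall d, (forall m, (0 < m)%N -> P m -> (d %| m)%N) -> d = 1%N) ->
  exists N, forall m, (N <= m)%N -> P m.
Proof.
move=> PD Pgcd.
have Pmul k a : P a -> (0 < k)%N -> P (k * a)%N.
  move=> Pa; elim: k => // -[_ _|k /(_ isT) IH _]; first by rewrite mul1n.
  by rewrite mulSn; exact: PD.
(* Without a positive element the premise on [d] would be vacuous, and [d = 0] would give
   [0 = 1]. *)
have [m0 m0_gt0 Pm0] : exists2 m, (0 < m)%N & P m.
  apply: contrapT => noP; suff : 0%N = 1%N by [].
  by apply: Pgcd => m m_gt0 Pm; case: noP; exists m.
pose D d := `[< (0 < d)%N /\ exists2 b, P b & P (b + d)%N >].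
have exD : exists d, D d.
  by exists m0; apply/asboolP; split => //; exists m0 => //; exact: PD.
case: (ex_minnP exD) => d /asboolP[d_gt0 [b Pb Pbd]] dmin.
have d1 : d = 1%N.
  apply: Pgcd => m m_gt0 Pm; rewrite /dvdn; apply: contrapT => /negP.
  rewrite -lt0n => r_gt0; suff : (d <= m %% d)%N by rewrite leqNgt ltn_pmod.
  apply: dmin; apply/asboolP; split => //.
  (* This element and [m + (m %/ d).+1 * b] differ by exactly the remainder [m %% d]. *)
  exists (m %/ d * (b + d) + b)%N.
    have [->//|q_gt0] := posnP (m %/ d); by apply: PD => //; exact: Pmul.
  have -> : (m %/ d * (b + d) + b + m %% d = m + (m %/ d).+1 * b)%N.
    rewrite {3}(divn_eq m d); ring.
  by apply: PD => //; exact: Pmul.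
rewrite d1 in Pbd; have [b0|b_gt0] := posnP b.
  by exists 1%N => m m_gt0; rewrite b0 in Pbd; rewrite -(muln1 m); exact: Pmul Pbd _.
exists (b * b)%N => m mbb.
have q_ge : (b <= m %/ b)%N by rewrite leq_divRL.
have r_lt : (m %% b < b)%N by rewrite ltn_pmod.
have -> : m = ((m %/ b - m %% b) * b + m %% b * (b + 1))%N.
  rewrite {1}(divn_eq m b) mulnBl mulnDr muln1 addnA subnK//.
  by rewrite leq_mul2r (leq_trans (ltnW r_lt) q_ge) orbT.
have P1 : P ((m %/ b - m %% b) * b)%N.
  by apply: Pmul => //; rewrite subn_gt0 (leq_trans r_lt).
have [r0|r_gt0] := posnP (m %% b); first by rewrite r0 in P1 *; rewrite mul0n addn0.
by apply: PD => //; exact: Pmul.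
Qed.

Lemma mxpow_gt0D n (A : 'M[nat]_n) (m m' : nat) i k j :
  (0 < (A ^+ m) i k)%N -> (0 < (A ^+ m') k j)%N -> (0 < (A ^+ (m + m')) i j)%N.
Proof.
move=> ik kj; rewrite exprD mxE lt0n sum_nat_eq0 negb_forall.
by apply/existsP; exists k; rewrite /= -lt0n muln_gt0 ik.
Qed.

(** Loops at [i] exist in all large lengths by [semigroup_cofinite]; one fixed path from [i] to [j]
    is appended to them. *)
Lemma primitive_mxpow n (A : 'M[nat]_n) : irreducible A -> aperiodic A ->
  exists N, forall m i j, (N <= m)%N -> (0 < (A ^+ m) i j)%N.
Proof.
move=> A_irr A_aper.
have /choice[N0 N0P] : forall i : 'I_n,
    exists N, forall m, (N <= m)%N -> (0 < (A ^+ m) i i)%N.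
  move=> i; apply: semigroup_cofinite => [a b|d]; first exact: mxpow_gt0D.
  exact: A_aper.
have /choice[r rP] : forall p : 'I_n * 'I_n,
    exists m, (0 < (A ^+ m) p.1 p.2)%N.
  by move=> [i j]; have [m _ ?] := A_irr i j; exists m.
exists (\max_(p : 'I_n * 'I_n) (N0 p.1 + r p))%N => m i j.
move=> /(leq_trans (leq_bigmax (F := fun p => (N0 p.1 + r p)%N) (i, j))) /= Nm.
rewrite -(subnK (leq_trans (leq_addl _ _) Nm)).
apply: mxpow_gt0D (rP (i, j)); apply: N0P.
by rewrite leq_subRL ?(leq_trans (leq_addl _ _) Nm)// addnC.
Qed.

Section points.
Context n (A : 'M[nat]_n) (A0 : sft A !=set0).
Local Notation X := (SFT A0).
Implicit Types x y z : X.

Lemma letter_inj x y : letter x =1 letter y -> x = y.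
Proof. by move=> xy; apply: val_inj; apply/funext. Qed.

Lemma letter_sft x k : A (letter x k) (letter x (k + 1)) = 1%N.
Proof. by have /set_mem := valP x; exact. Qed.

Lemma sft_pointP (f : int -> 'I_n) : (forall k, A (f k) (f (k + 1)) = 1%N) ->
  exists x, letter x =1 f.
Proof. by move=> fA; exists (exist _ f (mem_set fA)). Qed.

(** Admissibility concerns adjacent letters only, so one common letter suffices for gluing. *)
Lemma splice x y (p : int) : letter x p = letter y p ->
  exists z, (forall l, l <= p -> letter z l = letter x l) /\
            (forall l, p <= l -> letter z l = letter y l).
Proof.
move=> xyp; have [k|z zE] := @sft_pointP (fun l : int => if l <= p then letter x l else letter y l).
  case: ifPn => kp; case: ifPn => k1p; rewrite ?letter_sft//; last by lia.
  have -> : k = p by lia.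
  by rewrite xyp letter_sft.
exists z; split => l; rewrite zE => lp; first by rewrite lp.
case: ifPn => // lp'; have -> : l = p by lia.
by [].
Qed.

Lemma periodic_point x (p : int) (L : nat) : (0 < L)%N ->
  letter x p = letter x (p + L%:Z) ->
  exists z, (forall l, p <= l <= p + L%:Z -> letter z l = letter x l) /\
            (forall l, letter z (l + L%:Z) = letter z l).
Proof.
move=> L_gt0 xp; pose f l := letter x (p + ((l - p) %% L%:Z)%Z).
have L0 : L%:Z != 0 by lia.
have fin l : p <= l < p + L%:Z -> f l = letter x l.
  move=> lp; have lpL : 0 <= l - p < L%:Z by clear -lp; lia.
  by rewrite /f (modz_small lpL) addrC subrK.
have [k|z zE] := @sft_pointP f.
  rewrite /f (addrAC k) -[in X in A _ X]modzDml.
  have := ltz_pmod (k - p) (_ : 0 < L%:Z); have := modz_ge0 (k - p) L0.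
  move: ((k - p) %% L)%Z => r r0 /(_ _) rL.
  have {}rL : r < L by apply: rL; lia.
  have [r1L|Lr] := ltP (r + 1) L.
    by rewrite (@modz_small (r + 1)) ?addrA ?letter_sft//; clear -r0 r1L; lia.
  have -> : r + 1 = L by lia.
  by rewrite modzz addr0 xp -(letter_sft x (p + r)); congr (A _ (letter _ _)); lia.
exists z; split => l; rewrite !zE.
  move=> lp; have [?|?] := ltP l (p + L); first by apply: fin; lia.
  have -> : l = p + L by lia.
  by rewrite /f addrAC subrr add0r modzz addr0.
by rewrite /f addrAC modzDr.
Qed.

(** The gap is filled by a path of length [q - p] from the letter of [x] at [p] to that of [y] at
    [q]. The width [N] depends neither on the points nor on the position. *)
Lemma specification : irreducible A -> aperiodic A -> zero_one A ->
  exists2 N, (0 < N)%N & forall x y (p q : int), p + N%:Z <= q ->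
  exists z, (forall l, l <= p -> letter z l = letter x l) /\
            (forall l, q <= l -> letter z l = letter y l).
Proof.
move=> A_irr A_aper A01; have [N NP] := primitive_mxpow A_irr A_aper.
exists N.+1 => // x y p q pq.
have := NP `|(q - p)%R|%N (letter x p) (letter y q) _.
move=> /(_ ltac:(lia)) /path_of_mxpow[g [g0 gq gP]].
pose f (l : int) := if l <= p then letter x l else
            if l <= q then g `|(l - p)%R|%N else letter y l.
have [k|z zE] := @sft_pointP f; last first.
  exists z; split => l; rewrite zE /f => lp; first by rewrite lp.
  case: ifPn => [|_]; first by lia.
  case: ifPn => // lq; have -> : l = q by lia.
  by rewrite gq.
rewrite /f; have [kp|kp] := leP k p.
  have [k1p|k1p] := leP (k + 1) p; first exact: letter_sft.
  have -> : k = p by lia.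
  rewrite ifT; last by lia.
  have -> : `|(p + 1 - p)%R|%N = 1%N by lia.
  rewrite -g0; have /gP : (0 < `|(q - p)%R|)%N by lia.
  by case: (A01 (g 0%N) (g 1%N)) => ->.
have k1p : (k + 1 <= p) = false by lia.
rewrite k1p.
have [kq|kq] := leP k q; last first.
  by rewrite ifF ?letter_sft//; lia.
have [k1q|k1q] := leP (k + 1) q.
  have -> : `|(k + 1 - p)%R|%N = `|(k - p)%R|%N.+1 by lia.
  have /gP : (`|(k - p)%R| < `|(q - p)%R|)%N by lia.
  by case: (A01 (g `|(k - p)%R|%N) (g `|(k - p)%R|%N.+1)) => ->.
have -> : k = q by lia.
by rewrite gq letter_sft.
Qed.

End points.

(** * Cylinders *)

Section topology.
Context n (A : 'M[nat]_n) (A0 : sft A !=set0).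
Local Notation X := (SFT A0).
Implicit Types (x y z : X) (E : set X).

Definition agree (k : nat) x y :=
  forall l : int, (`|l| < k)%N -> letter x l = letter y l.

(** These are the unions of cylinders over [|l| < k], hence clopen sets. *)
Definition determined (k : nat) E := forall x y, agree k x y -> E x -> E y.

Lemma agreeW j k x y : (j <= k)%N -> agree k x y -> agree j x y.
Proof. by move=> jk xy l lj; apply: xy; exact: leq_trans jk. Qed.

Lemma agree_sym k x y : agree k x y -> agree k y x.
Proof. by move=> xy l lk; rewrite xy. Qed.

Lemma determinedW j k E : (j <= k)%N -> determined j E -> determined k E.
Proof. by move=> jk Ej x y xy; apply: Ej; exact: agreeW xy. Qed.

Lemma determinedC k E : determined k E -> determined k (~` E).
Proof. by move=> kE x y /agree_sym xy nEx Ey; apply: nEx; exact: kE Ey. Qed.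

Lemma determinedU k E F : determined k E -> determined k F -> determined k (E `|` F).
Proof. by move=> kE kF x y xy [Ex|Fx]; [left; exact: kE Ex|right; exact: kF Fx]. Qed.

(** The cylinders around [x] generate a filter that converges to [x] in each coordinate, hence in
    the product topology. *)
Lemma nbhs_prod_window (x : prod_topology (fun _ : int => discrete_topology 'I_n))
    (U : set (prod_topology (fun _ : int => discrete_topology 'I_n))) :
  nbhs x U -> exists k : nat, forall y : prod_topology (fun _ : int => discrete_topology 'I_n),
    (forall l : int, (`|l| < k)%N -> x l = y l) -> U y.
Proof.
pose cyl k := [set y : prod_topology (fun _ : int => discrete_topology 'I_n) |
  forall l : int, (`|l| < k)%N -> x l = y l].
pose F := filter_from [set: nat] cyl.
have FF : Filter F.
  apply: filter_from_filter; first by exists 0%N.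
  move=> i j _ _; exists (maxn i j) => // y xy.
  by split=> l li; apply: xy; rewrite leq_max li ?orbT.
have Fx : F --> x.
  apply/cvg_sup => i V [_ [[W Wop <-] Wx] /= WV].
  exists `|i|.+1 => // y /(_ i (ltnSn _)) xyi; apply: WV.
  by rewrite /= -xyi.
by move=> /Fx [k _ kU]; exists k => y xy; exact: kU.
Qed.

Lemma nbhs_window x (U : set X) : nbhs x U -> exists k, forall y, agree k x y -> U y.
Proof.
move=> [_ [[V Vop <-] Vx] VU].
have /nbhs_prod_window[k kV] : nbhs (set_val x) V by exact: open_nbhs_nbhs.
by exists k => y xy; apply: VU; apply: kV.
Qed.

Lemma prod_letter_nbhs (f : prod_topology (fun _ : int => discrete_topology 'I_n)) (l : int) :
  nbhs f [set g : prod_topology (fun _ : int => discrete_topology 'I_n) | f l = g l].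
Proof.
apply: (@proj_continuous int (fun _ => discrete_topology 'I_n) _ f [set a | f _ = a]).
exact/principal_filterP.
Qed.

Lemma letter_nbhs x (l : int) : nbhs x [set y | letter x l = letter y l].
Proof.
have := @prod_letter_nbhs (set_val x) l; rewrite nbhsE => -[B [oB Bx] BV].
by exists (set_val @^-1` B); split => [|//|y /BV//]; exists B.
Qed.

Lemma nbhs_agree x k : nbhs x (agree k x).
Proof.
elim: k => [|k IHk].
  by apply: (@filterS _ _ (nbhs_filter x) setT) => [y _ l|]; [rewrite ltn0|exact: filterT].
have := @filterI _ _ (nbhs_filter x) _ _ IHk
  (@filterI _ _ (nbhs_filter x) _ _ (letter_nbhs x k%:Z) (letter_nbhs x (- k%:Z))).
apply: (@filterS _ _ (nbhs_filter x)) => y [xy [ky kNy]] l.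
rewrite ltnS leq_eqVlt => /predU1P[lk|/xy//].
have [->//|->//] : l = k \/ l = - k%:Z by lia.
Qed.

Lemma determined_open k E : determined k E -> open E.
Proof.
move=> kE; rewrite openE => x Ex.
by apply: (@filterS _ _ (nbhs_filter x)) (nbhs_agree x k) => y xy; exact: kE Ex.
Qed.

Lemma determined_measurable k E : determined k E -> measurable E.
Proof. by move=> /determined_open oE; exact: sub_sigma_algebra. Qed.

Lemma open_bigcup_determined (U : set X) : open U ->
  exists2 V : nat -> set X, (forall k, determined k (V k)) /\
    nondecreasing_seq V & U = \bigcup_k V k.
Proof.
move=> oU; exists (fun k => [set x | forall y, agree k x y -> U y]).
  split=> [k x y xy Vx z yz|i j ij].
    by apply: Vx => l lk; rewrite xy// yz.
  by apply/subsetPset => x Vx y xy; apply: Vx; exact: agreeW xy.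
apply/seteqP; split => x; last by move=> [k _]; apply.
by move=> Ux; have [k kU] := nbhs_window (open_nbhs_nbhs (conj oU Ux)); exists k.
Qed.

Lemma open_window_preimage (f : X -> X) :
  (forall k, exists j, forall x y, agree j x y -> agree k (f x) (f y)) ->
  measurable_fun setT f.
Proof.
move=> fP; apply: (measurability (@open X)) => // _ [U oU <-].
rewrite setTI; apply: sub_sigma_algebra; rewrite /= openE => x Ux.
have [k kU] := nbhs_window (open_nbhs_nbhs (conj oU Ux)).
by have [j jf] := fP k; apply: (@filterS _ _ (nbhs_filter x)) (nbhs_agree x j) => y /jf /kU.
Qed.

Lemma sft_compact : compact (sft A).
Proof.
have cT : compact [set: prod_topology (fun _ : int => discrete_topology 'I_n)].
  have -> : [set: prod_topology (fun _ : int => discrete_topology 'I_n)] =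
      [set f | forall i, [set: discrete_topology 'I_n] (f i)].
    by apply/seteqP; split.
  apply: (@tychonoff int (fun _ => discrete_topology 'I_n) (fun _ => setT)) => i.
  by apply: finite_compact; exact: (@finite_finset 'I_n).
apply: (subclosed_compact _ cT) => // f clf; rewrite /sft /= => k.
have : nbhs f [set g : prod_topology (fun _ : int => discrete_topology 'I_n) |
    f k = g k /\ f (k + 1) = g (k + 1)].
  by apply: filterI; exact: prod_letter_nbhs.
by move=> /clf[g [gA [-> ->]]]; exact: gA.
Qed.

(** Otherwise counterexamples [u k] accumulate at some [x]. On a cylinder of [x] some [P k] holds,
    and this cylinder contains [u j] for some [j >= k], against monotonicity. *)
Lemma compact_bound (P : nat -> X -> Prop) :
  (forall i j x, (i <= j)%N -> P i x -> P j x) ->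
  (forall x, exists k, forall y, agree k x y -> P k y) ->
  exists k, forall y, P k y.
Proof.
move=> Pmono Ploc; apply: contrapT => noP.
have /choice[u uP] : forall k, exists y, ~ P k y.
  move=> k; apply: contrapT => /forallNP Pk; apply: noP; exists k => y.
  by apply: contrapT; exact: Pk.
have [|f [fA Fcl]] := @sft_compact ((set_val \o u) @ \oo) _.
  by exists 0%N => // k _; have /set_mem := valP (u k).
have [x xE] := sft_pointP A0 fA.
have {Ploc}[k kP] := Ploc x.
have : nbhs f [set g : prod_topology (fun _ : int => discrete_topology 'I_n) |
    forall l : int, (`|l| < k)%N -> f l = g l].
  elim: k {kP} => [|k IHk].
    by apply: (@filterS _ _ (nbhs_filter f) setT) => [y _ l|]; [rewrite ltn0|exact: filterT].
  have pc := prod_letter_nbhs f.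
  apply: filterS (filterI IHk (filterI (pc k%:Z) (pc (- k%:Z)))) => g [fg [kg kNg]] l.
  rewrite ltnS leq_eqVlt => /predU1P[lk|/fg//].
  have [->//|->//] : l = k \/ l = - k%:Z by lia.
have : ((set_val \o u) @ \oo) [set (set_val \o u) j | j in [set j | (k <= j)%N]].
  by exists k => // j /= kj; exists j.
move=> /Fcl /[apply] -[_ [[j /= kj <-] fu]].
apply: (uP j); apply: Pmono kj _; apply: kP => l lk.
by rewrite xE fu.
Qed.

End topology.

(** * Exchanging words *)

Section swap.
Context n (A : 'M[nat]_n) (A0 : sft A !=set0).
Local Notation X := (SFT A0).
Implicit Types (x y z : X) (a d l : int) (w : seq 'I_n).

Definition word a (m : nat) x : seq 'I_n :=
  mkseq (fun i => letter x (a + i%:Z)) m.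

Lemma eq_word a m x y d :
  word (a + d) m x = word a m y <->
  forall l, a <= l < a + m%:Z -> letter x (l + d) = letter y l.
Proof.
split=> [xy l lm|xy]; last first.
  apply/eq_in_map => i; rewrite mem_iota => im; rewrite addrAC xy//; lia.
have lE : l = a + `|l - a|%N%:Z by lia.
have : nth (letter x 0) (word (a + d) m x) `|l - a|%N =
       nth (letter x 0) (word a m y) `|l - a|%N by rewrite xy.
rewrite !nth_mkseq; try by lia.
by rewrite addrAC -lE.
Qed.

Lemma eq_word0 a m x y :
  word a m x = word a m y <->
  forall l, a <= l < a + m%:Z -> letter x l = letter y l.
Proof.
rewrite -{1}(addr0 a) eq_word; split=> xy l /xy; by rewrite addr0.
Qed.

Definition patch_fun a w x l : 'I_n :=
  if (a <= l < a + (size w)%:Z) then nth (letter x l) w `|(l - a)%R|%N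
  else letter x l.

(* [x] itself when the patched sequence is not admissible *)
Definition patch a w x : X := xget x [set z | letter z =1 patch_fun a w x].

(** Exchanging in both directions, and fixing all points where the exchange is impossible, makes
    this an involution of the whole space. It is thus a Borel automorphism that moves points only
    inside their Gibbs classes. *)
Definition swap a w w' x : X :=
  if size w == size w' then
    if word a (size w) x == w then patch a w' x
    else if word a (size w) x == w' then patch a w x else x
  else x.

Lemma patch_funP a w x y m : size w = m -> word a m y = w ->
  (forall l, ~~ (a <= l < a + m%:Z) -> letter x l = letter y l) ->
  letter y =1 patch_fun a w x.
Proof.
move=> sw yw xy l; rewrite /patch_fun sw.
case: ifPn => [lm|/xy//]; rewrite -yw nth_mkseq; last by lia.
by congr letter; lia.
Qed.

Lemma patchE a w x y m : size w = m -> word a m y = w ->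
  (forall l, ~~ (a <= l < a + m%:Z) -> letter x l = letter y l) ->
  patch a w x = y.
Proof.
move=> sw yw xy; have yE := patch_funP sw yw xy.
apply: letter_inj => l; rewrite /patch.
by case: xgetP => [z _ ->|/(_ y)/= /(_ yE)//]; rewrite yE.
Qed.

Lemma patch_letter a w x : (exists z, letter z =1 patch_fun a w x) ->
  letter (patch a w x) =1 patch_fun a w x.
Proof. by move=> [z zE]; rewrite /patch; case: xgetP => [y _ //|/(_ z)]. Qed.

Lemma patch_out a w x l : ~~ (a <= l < a + (size w)%:Z) ->
  letter (patch a w x) l = letter x l.
Proof.
move=> /negbTE lw; rewrite /patch; case: xgetP => [y _ ->|//].
by rewrite /patch_fun lw.
Qed.

Lemma patch_word a w x : patch a w x = x \/ word a (size w) (patch a w x) = w.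
Proof.
rewrite /patch; case: xgetP => [y _ /= yE|]; last by left.
right; apply: (@eq_from_nth _ (letter x 0)); rewrite size_mkseq// => i iw.
rewrite nth_mkseq// yE /patch_fun ifT; last by lia.
have -> : `|(a + i%:Z - a)%R|%N = i by lia.
exact: set_nth_default.
Qed.

Lemma swap_out a w w' x l : ~~ (a <= l < a + (size w)%:Z) ->
  letter (swap a w w' x) l = letter x l.
Proof.
move=> lw; rewrite /swap; case: eqP => // ww'.
by case: ifP => _; [|case: ifP => // _]; rewrite patch_out// -ww'.
Qed.

Lemma swapE a m x y : (forall l, ~~ (a <= l < a + m%:Z) -> letter x l = letter y l) ->
  swap a (word a m x) (word a m y) x = y.
Proof.
move=> xy; rewrite /swap !size_mkseq !eqxx.
by apply: patchE xy; rewrite ?size_mkseq.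
Qed.

Lemma swapK a w w' : involutive (swap a w w').
Proof.
move=> x; rewrite {2}/swap; case: (eqVneq (size w) (size w')) => [sw|]; last first.
  by rewrite /swap => /negbTE ->.
set s := size w in sw *.
have E v v' : size v = s -> size v' = s -> word a s x = v ->
    patch a v' x = x \/
    [/\ word a s (patch a v' x) = v' & patch a v (patch a v' x) = x].
  move=> sv sv' xv; have [->|] := patch_word a v' x; [by left|].
  rewrite sv' => pw; right; split => //; apply: (patchE sv xv) => l ls.
  by rewrite patch_out// sv'.
case: (eqVneq (word a s x) w) => [xw|xNw].
  have [p|[pw' pK]] := E w w' erefl (esym sw) xw.
    by rewrite p /swap -/s xw eqxx p if_same.
  rewrite /swap -/s pw' sw eqxx; case: (eqVneq w' w) => [w'w|_].
    by rewrite -w'w in pK *.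
  by rewrite eqxx.
case: (eqVneq (word a s x) w') => [xw'|xNw'].
  have [p|[pw pK]] := E w' w (esym sw) erefl xw'.
    by rewrite p /swap -/s (negbTE xNw) xw' eqxx p if_same.
  by rewrite /swap -/s pw sw !eqxx.
by rewrite /swap -/s (negbTE xNw) (negbTE xNw') if_same.
Qed.

Lemma patch_fun_local a w x y d :
  (forall l, a - 1 <= l <= a + (size w)%:Z -> letter x (l + d) = letter y l) ->
  forall l, a - 1 <= l <= a + (size w)%:Z ->
  patch_fun (a + d) w x (l + d) = patch_fun a w y l.
Proof.
move=> xy l lw; rewrite /patch_fun xy//.
have -> : (a + d <= l + d < a + d + (size w)%:Z) = (a <= l < a + (size w)%:Z) by lia.
by have -> : l + d - (a + d) = l - a by lia.
Qed.

(** Only the new word and its two junctions have to be checked, which is why one extra letter on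
    either side enters. *)
Lemma patch_admissible_local a w x y d :
  (forall l, a - 1 <= l <= a + (size w)%:Z -> letter x (l + d) = letter y l) ->
  (exists z, letter z =1 patch_fun (a + d) w x) ->
  exists z, letter z =1 patch_fun a w y.
Proof.
move=> xy [z zE]; apply: (@sft_pointP _ _ A0) => k.
have [kw|kNw] := boolP (a - 1 <= k <= a + (size w)%:Z - 1); last first.
  rewrite /patch_fun !ifF; first exact: letter_sft.
    by lia.
  by lia.
rewrite -!(patch_fun_local xy); [|by lia..].
by rewrite -!zE addrAC letter_sft.
Qed.

Lemma patch_local a w x y d :
  (forall l, a - 1 <= l <= a + (size w)%:Z -> letter x (l + d) = letter y l) ->
  forall l, a - 1 <= l <= a + (size w)%:Z ->
  letter (patch (a + d) w x) (l + d) = letter (patch a w y) l.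
Proof.
move=> xy l lw; have yx k : a + d - 1 <= k <= a + d + (size w)%:Z ->
    letter y (k - d) = letter x k.
  by move=> kw; rewrite -xy ?subrK//; lia.
have [ex|nex] := pselect (exists z, letter z =1 patch_fun a w y).
  rewrite (patch_letter ex) patch_letter ?(patch_fun_local xy)//.
  by apply: (@patch_admissible_local _ _ _ _ (- d)) yx _; rewrite addrK.
rewrite {2}/patch; case: xgetP => [z _ /= zE|_]; first by case: nex; exists z.
rewrite /patch; case: xgetP => [z _ /= zE|_]; last exact: xy.
by case: nex; apply: patch_admissible_local xy _; exists z.
Qed.

Lemma swap_local a w w' x y d :
  (forall l, a - 1 <= l <= a + (size w)%:Z -> letter x (l + d) = letter y l) ->
  forall l, a - 1 <= l <= a + (size w)%:Z ->
  letter (swap (a + d) w w' x) (l + d) = letter (swap a w w' y) l.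
Proof.
move=> xy l lw; rewrite /swap; case: eqP => [sw|_]; last exact: xy.
have -> : word (a + d) (size w) x = word a (size w) y.
  by apply/eq_word => k kw; apply: xy; lia.
by case: ifP => _; [|case: ifP => _]; rewrite ?xy//; apply: patch_local;
  rewrite -?sw.
Qed.

Lemma swap_agree a w w' (k : nat) x y :
  (forall l, a - 1 <= l <= a + (size w)%:Z -> (`|l| < k)%N) ->
  agree k x y -> agree k (swap a w w' x) (swap a w w' y).
Proof.
move=> wk xy l lk; have [lw|lNw] := boolP (a <= l < a + (size w)%:Z); last first.
  by rewrite !swap_out// xy.
have := @swap_local a w w' x y 0 _ l _; rewrite !addr0; apply; last by lia.
by move=> i iw; rewrite addr0; apply: xy; exact: wk.
Qed.

Lemma swap_measurable a w w' : measurable_fun setT (swap a w w').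
Proof.
apply: open_window_preimage => k; exists (maxn k (`|a| + size w).+2) => x y xy.
apply: (@agreeW _ _ _ _ (maxn k (`|a| + size w).+2)); first exact: leq_maxl.
by apply: swap_agree xy => l lw; rewrite leq_max; apply/orP; right; lia.
Qed.

HB.instance Definition _ a w w' :=
  isMeasurableFun.Build _ _ _ _ (swap a w w') (@swap_measurable a w w').

Lemma gibbs_window x y : gibbs_relation (x, y) ->
  exists k : nat, forall l : int, (k <= `|l|)%N -> letter x l = letter y l.
Proof.
move=> /finite_seqP[s /= sE]; exists (\max_(l <- s) `|l|).+1 => l lk.
apply: contrapT => xyl; have : l \in s.
  by have : [set` s] l by rewrite -sE.
by move=> /(@leq_bigmax_seq _ s xpredT absz l) /(_ isT); rewrite leqNgt lk.
Qed.

Lemma window_gibbs (k : nat) x y :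
  (forall l : int, (k <= `|l|)%N -> letter x l = letter y l) ->
  gibbs_relation (x, y).
Proof.
move=> xy; apply: (@sub_finite_set _ _
  [set l | l \in [seq i%:Z - k%:Z | i <- iota 0 (k + k)]]); last exact: finite_seq.
move=> l /= xyl; have lk : (`|l| < k)%N by rewrite ltnNge; apply/negP => /xy.
by apply/mapP; exists `|(l + k%:Z)%R|%N; [rewrite mem_iota; lia|lia].
Qed.

Lemma swap_gibbs a w w' x : gibbs_relation (x, swap a w w' x).
Proof.
apply: (@window_gibbs (`|a| + size w).+1) => l la.
by rewrite swap_out//; lia.
Qed.

(** So the countably many exchanges generate the Gibbs relation, and saturations become countable
    unions of preimages. *)
Lemma gibbs_swap x y : gibbs_relation (x, y) ->
  exists a w w', swap a w w' x = y.
Proof.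
move=> /gibbs_window[k xy].
exists (- k%:Z), (word (- k%:Z) (k + k) x), (word (- k%:Z) (k + k) y).
by apply: swapE => l lk; apply: xy; lia.
Qed.

End swap.

(** * Energy *)

Section sums.
Context {R : realType}.
Implicit Types (u v w : int -> R).

Definition summable_int u : Prop :=
  cvgn (series (fun k => u k%:Z)) /\ cvgn (series (fun k => u (- k.+1%:Z))).

Lemma sum_intD u v : summable_int u -> summable_int v ->
  sum_int (fun k => u k + v k) = sum_int u + sum_int v.
Proof.
move=> [u1 u2] [v1 v2]; rewrite /sum_int.
have -> : (fun k : nat => u k%:Z + v k%:Z) = (fun k => u k%:Z) \+ (fun k => v k%:Z) by [].
have -> : (fun k : nat => u (- k.+1%:Z) + v (- k.+1%:Z)) =
  (fun k => u (- k.+1%:Z)) \+ (fun k => v (- k.+1%:Z)) by [].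
by rewrite !lim_seriesD// addrACA.
Qed.

Lemma series_dominated (u w : nat -> R) (C : R) : (forall k, `|u k| <= w k) ->
  (forall N, \sum_(0 <= k < N) w k <= C) ->
  cvgn (series u) /\ `|limn (series u)| <= C.
Proof.
move=> uw wC.
have uC N : \sum_(0 <= k < N) `|u k| <= C.
  by apply: le_trans (wC N); exact: ler_sum.
have cu : cvgn (series u).
  apply: normed_cvg; apply: nondecreasing_is_cvgn.
    apply: (@nondecreasing_series _ _ xpredT 0%N) => i _ _ /=; exact: normr_ge0.
  by exists C => _ [N _ <-]; exact: uC.
split => //.
have uN N : `|series u N| <= C by apply: le_trans (uC N); exact: ler_norm_sum.
rewrite ler_norml; apply/andP; split.
  by apply: limr_ge => //; apply: nearW => N; have := uN N; rewrite ler_norml => /andP[].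
by apply: limr_le => //; apply: nearW => N; have := uN N; rewrite ler_norml => /andP[].
Qed.

Lemma sum_int_dominated u w (C : R) : (forall k, `|u k| <= w k) ->
  (forall N, \sum_(0 <= k < N) w k%:Z <= C) ->
  (forall N, \sum_(0 <= k < N) w (- k.+1%:Z) <= C) ->
  summable_int u /\ `|sum_int u| <= C *+ 2.
Proof.
move=> uw w1 w2.
have [c1 l1] := @series_dominated (fun k => u k%:Z) (fun k => w k%:Z) C (fun k => uw _) w1.
have [c2 l2] := @series_dominated (fun k => u (- k.+1%:Z))
  (fun k => w (- k.+1%:Z)) C (fun k => uw _) w2.
by split => //; rewrite mulr2n (le_trans (ler_normD _ _))// lerD.
Qed.

Lemma sum_uniq_le (w : nat -> R) (C : R) (s : seq nat) : (forall k, 0 <= w k) ->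
  (forall N, \sum_(0 <= k < N) w k <= C) -> uniq s -> \sum_(i <- s) w i <= C.
Proof.
move=> w0 wC us; pose N := (\max_(i <- s) i).+1.
have sN i : i \in s -> (i < N)%N by move=> si; rewrite ltnS; exact: (@leq_bigmax_seq _ s xpredT id).
apply: le_trans (wC N).
have -> : \sum_(i <- s) w i = \sum_(0 <= k < N | k \in s) w k.
  rewrite -[RHS]big_filter; apply: perm_big; apply: uniq_perm => //.
    by rewrite filter_uniq// iota_uniq.
  move=> i; rewrite mem_filter mem_index_iota/=.
  by case: (boolP (i \in s)) => // /sN ->.
by rewrite big_mkcond/=; apply: ler_sum => i _; case: ifP.
Qed.

(** Each distance to [p] occurs at most once on either side of [p], whence the factor 2. *)
Lemma sum_dist_le (w : nat -> R) (C : R) (p : int) (N : nat) : (forall k, 0 <= w k) ->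
  (forall N, \sum_(0 <= k < N) w k <= C) ->
  \sum_(0 <= k < N) w `|(k%:Z - p)%R|%N <= C *+ 2.
Proof.
move=> w0 wC; rewrite (bigID (fun k : nat => p <= k%:Z))/= mulr2n.
have E (P : pred nat) : (forall i j : nat, P i -> P j ->
      `|(i%:Z - p)%R|%N = `|(j%:Z - p)%R|%N -> i = j) ->
    \sum_(0 <= k < N | P k) w `|(k%:Z - p)%R|%N <= C.
  move=> Pinj; rewrite -big_filter -(big_map (fun k : nat => `|(k%:Z - p)%R|%N) xpredT w).
  apply: sum_uniq_le => //; rewrite map_inj_in_uniq ?filter_uniq ?iota_uniq//.
  by move=> i j; rewrite !mem_filter => /andP[Pi _] /andP[Pj _]; exact: Pinj.
by apply: lerD; apply: E => i j; lia.
Qed.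

(** The factor 4 counts the two half-lines of [sum_int] and, in each, the two sides of a point of
    [Lp]. *)
Lemma sum_int_dist_bound (w : nat -> R) (C : R) (Lp : seq int) u (c : R) :
  (forall k, 0 <= w k) -> (forall N, \sum_(0 <= k < N) w k <= C) -> 0 <= c ->
  (forall j, `|u j| <= c * \sum_(p <- Lp) w `|(j - p)%R|%N) ->
  summable_int u /\ `|sum_int u| <= c * (size Lp)%:R * C *+ 4.
Proof.
move=> w0 wC c0 uw.
have -> : c * (size Lp)%:R * C *+ 4 = (c * ((size Lp)%:R * (C *+ 2))) *+ 2.
  by ring.
have sumL (f : nat -> int -> nat) :
    (forall p N, \sum_(0 <= k < N) w (f k p) <= C *+ 2) ->
    forall N, \sum_(0 <= k < N) (c * \sum_(p <- Lp) w (f k p)) <= c * ((size Lp)%:R * (C *+ 2)).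
  move=> fC N; rewrite -mulr_sumr ler_wpM2l// exchange_big/=.
  apply: le_trans (ler_sum _ (fun p _ => fC p N)) _.
  by rewrite big_const_seq count_predT iter_addr_0 mulr_natl.
apply: (@sum_int_dominated _ (fun j => c * \sum_(p <- Lp) w `|(j - p)%R|%N)) => //.
  by apply: (sumL (fun k p => `|(k%:Z - p)%R|%N)) => p N; exact: sum_dist_le.
apply: (sumL (fun k p => `|(- k.+1%:Z - p)%R|%N)) => p N.
(* Reflection: [- k.+1 - p] and [k - (- p - 1)] have the same absolute value. *)
have := @sum_dist_le w C (- p - 1) N w0 wC; apply: le_trans.
by apply: ler_sum => k _; rewrite le_eqVlt; apply/orP; left; apply/eqP; congr w; lia.
Qed.

End sums.

Section variation.
Context n (A : 'M[nat]_n) (A0 : sft A !=set0) (R : realType).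
Local Notation X := (SFT A0).
Context (phi : X -> R) (phi_cont : continuous phi) (phi_sv : summable_variation phi).
Implicit Types (x y : X).

(** Boundedness makes the suprema in [omega] genuine upper bounds rather than default values of
    [sup]. *)
Lemma phi_bounded : exists C, forall x, `|phi x| <= C.
Proof.
have [||k kP] := @compact_bound _ _ A0 (fun k x => `|phi x| <= k%:R).
- by move=> i j x ij /le_trans; apply; rewrite ler_nat.
- move=> x; have [k kP] : exists k, forall y, agree k x y -> `|phi x - phi y| < 1.
    have := @phi_cont x [set r | `|phi x - r| < 1].
    move=> /(_ _)/nbhs_window; apply; apply/nbhs_ballP; exists 1 => //=.
  exists (maxn k (Num.bound (`|phi x| + 1))) => y xy.
  have {}/kP xy1 := agreeW (leq_maxl _ _) xy.
  apply: (@le_trans _ _ (Num.bound (`|phi x| + 1))%:R); last first.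
    by rewrite ler_nat leq_maxr.
  apply: le_trans (ltW (archi_boundP _)); last by rewrite addr_ge0.
  rewrite addrC -lerBlDr; apply: le_trans (ltW xy1); rewrite distrC.
  exact: lerB_dist.
by exists k%:R.
Qed.

Lemma has_ubound_omega k : has_ubound [set r | exists x x' : X,
    (forall l : int, (`|l| < k)%N -> letter x l = letter x' l) /\
    r = `|phi x - phi x'|].
Proof.
have [C phiC] := phi_bounded; exists (C + C) => _ [x [y [_ ->]]].
by rewrite (le_trans (ler_normB _ _))// lerD.
Qed.

Lemma omega_ge k x y : agree k x y -> `|phi x - phi y| <= omega phi k.
Proof. by move=> xy; apply: ub_le_sup; [exact: has_ubound_omega|exists x, y]. Qed.

Lemma omega_ge0 k : 0 <= omega phi k.
Proof.
by apply: le_trans (@omega_ge k point point _) => // l _.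
Qed.

Lemma omega_summable : exists C, forall N, \sum_(0 <= k < N) omega phi k <= C.
Proof.
have o0 k : (0 <= (omega phi k)%:E)%E by rewrite lee_fin omega_ge0.
have fs : (\sum_(0 <= k <oo) (omega phi k)%:E)%E \is a fin_num.
  by rewrite ge0_fin_numE//; exact: nneseries_ge0.
exists (fine (\sum_(0 <= k <oo) (omega phi k)%:E)%E) => N.
rewrite -lee_fin fineK// -sumEFin.
by apply: nneseries_lim_ge => k _ _; exact: o0.
Qed.

(* The coordinates in [Lp] separate the regions where nothing changes from those
   where [(x, y)] and [(x', y')] are exchanged. *)
Definition exchanged (Lp : seq int) x x' y y' := forall (j : int) (d : nat),
  (forall p, p \in Lp -> (d <= `|(j - p)%R|)%N) ->
  (forall l : int, (`|(l - j)%R| < d)%N ->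
    letter x l = letter x' l /\ letter y l = letter y' l) \/
  (forall l : int, (`|(l - j)%R| < d)%N ->
    letter x l = letter y' l /\ letter x' l = letter y l).

(** For a Gibbs measure this is the logarithm of the Radon-Nikodym derivative at [(x', x)], up to a
    null set. *)
Definition energy x' x : R :=
  sum_int (fun k => phi (sft_shift k x') - phi (sft_shift k x)).

(** Let [d] be the distance from [j] to the nearest point of [Lp]. Within distance less than [d] of
    [j] the four points agree in pairs, so the four values of [phi] pair up into two differences,
    each at most [omega phi d]. *)
Lemma exchanged_bound Lp x x' y y' j : (0 < size Lp)%N -> exchanged Lp x x' y y' ->
  `|(phi (sft_shift j x') - phi (sft_shift j x)) +
    (phi (sft_shift j y') - phi (sft_shift j y))| <=
  2 * \sum_(p <- Lp) omega phi `|(j - p)%R|%N.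
Proof.
move=> Lp0 ex.
have [p pL pmin] : exists2 p, p \in Lp &
    forall q, q \in Lp -> (`|(j - p)%R| <= `|(j - q)%R|)%N.
  elim: Lp Lp0 {ex} => // p [|q s] IH _.
    by exists p; rewrite ?mem_head// => q; rewrite inE => /eqP ->.
  have [//|r rs rmin] := IH; case: (leqP `|(j - p)%R|%N `|(j - r)%R|%N) => pr.
    exists p; rewrite ?mem_head// => t; rewrite inE => /predU1P[->//|/rmin].
    exact: leq_trans.
  exists r; rewrite ?(in_cons p) ?rs ?orbT// => t; rewrite inE => /predU1P[->|/rmin//].
  exact: ltnW.
apply: (@le_trans _ _ (2 * omega phi `|(j - p)%R|%N)); last first.
  rewrite ler_wpM2l// (big_rem p)//= lerDl; apply: sumr_ge0 => q _.
  exact: omega_ge0.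
rewrite mulr_natl mulr2n.
have sh (a b : X) : (forall l : int, (`|(l - j)%R| < `|(j - p)%R|)%N -> letter a l = letter b l) ->
    `|phi (sft_shift j a) - phi (sft_shift j b)| <= omega phi `|(j - p)%R|%N.
  by move=> ab; apply: omega_ge => l lj; rewrite !letter_shift ab// addrK.
have [E|E] := ex j _ pmin.
  by apply: le_trans (ler_normD _ _) _; apply: lerD; apply: sh => l /E[].
have -> : forall a b c e : R, (a - b) + (c - e) = (a - e) + (c - b).
  by move=> *; ring.
by apply: le_trans (ler_normD _ _) _; apply: lerD; apply: sh => l /E[].
Qed.

(** This is [exchanged_bound] with [y = y' = x], all coordinates of the window being put into [Lp].
    Only their number enters, not the position [a]. *)
Lemma energy_window : exists C, forall (a : int) (m : nat) x x',
  (forall l, ~~ (a <= l < a + m%:Z) -> letter x l = letter x' l) ->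
  summable_int (fun k => phi (sft_shift k x') - phi (sft_shift k x)) /\
  `|energy x' x| <= C * m.+1%:R.
Proof.
have [C sC] := omega_summable; exists (2 * C *+ 4) => a m x x' xx'.
(* One coordinate more than the window has, so that [Lp] is nonempty even for [m = 0]. *)
pose Lp := [seq a + i%:Z | i <- iota 0 m.+1].
have := @sum_int_dist_bound _ (omega phi) C Lp
  (fun k => phi (sft_shift k x') - phi (sft_shift k x)) 2 omega_ge0 sC (ler0n _ 2).
rewrite size_map size_iota => -[j|? ?]; last first.
  split => //; have -> // : 2 * C *+ 4 * m.+1%:R = 2 * m.+1%:R * C *+ 4 :> R.
  by ring.
have := @exchanged_bound Lp x x' x x j isT; rewrite subrr addr0; apply.
move=> i d iL; left=> l li; split=> //; apply: xx'.
apply/negP => la; have lL : l \in Lp.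
  by apply/mapP; exists `|(l - a)%R|%N; [rewrite mem_iota; lia|lia].
have := iL l lL; lia.
Qed.

(** The central change from [x] to [x'] is undone from [y] to [y'], so the contributions cancel over
    [|l| < k], and nothing changes far outside. Only the two collars count, and the bound is uniform
    in [k]. *)
Lemma energy_exchange : exists C, forall (k N : nat) x x' y y', 
  (forall l : int, (k + N <= `|l|)%N -> letter x l = letter x' l) ->
  (forall l : int, (k + N <= `|l|)%N -> letter y l = letter y' l) ->
  agree k x y' -> agree k x' y ->
  `|energy x' x + energy y' y| <= C * N.+1%:R.
Proof.
have [C sC] := omega_summable; exists (2 * C *+ 8) => k N x x' y y' xx' yy' xy' x'y.
pose Lp := [seq (k + i)%N%:Z | i <- iota 0 N.+1] ++ [seq - (k + i)%N%:Z | i <- iota 0 N.+1].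
have LpP l : (k <= `|l| <= k + N)%N -> l \in Lp.
  move=> lk; rewrite mem_cat; apply/orP; have [l0|l0] := leP 0 l.
    by left; apply/mapP; exists (`|l| - k)%N; [rewrite mem_iota; lia|lia].
  by right; apply/mapP; exists (`|l| - k)%N; [rewrite mem_iota; lia|lia].
have [Cw cw] := energy_window.
have wsum a b : (forall l : int, (k + N <= `|l|)%N -> letter a l = letter b l) ->
    summable_int (fun k => phi (sft_shift k b) - phi (sft_shift k a)).
  move=> ab; apply: (proj1 (cw (- (k + N)%N%:Z) (k + N + (k + N))%N a b _)).
  by move=> l lk; apply: ab; lia.
have := sum_intD (wsum _ _ xx') (wsum _ _ yy').
rewrite -/(energy x' x) -/(energy y' y) => <-.
have := @sum_int_dist_bound _ (omega phi) C Lp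
  (fun k => (phi (sft_shift k x') - phi (sft_shift k x)) +
            (phi (sft_shift k y') - phi (sft_shift k y))) 2 omega_ge0 sC (ler0n _ 2).
rewrite size_cat !size_map size_iota => -[j|_ h]; last first.
  apply: le_trans h _; rewrite natrD le_eqVlt; apply/orP; left; apply/eqP.
  by ring.
apply: exchanged_bound => // i d id.
have [ik|ki] := ltnP `|i| k.
  right => l li; split; [apply: xy'|apply: x'y].
    by have := id k (LpP k _); have := id (-k%:Z) (LpP (-k%:Z) _); lia.
  by have := id k (LpP k _); have := id (-k%:Z) (LpP (-k%:Z) _); lia.
left => l li; have : (k + N <= `|l|)%N.
  have [iN|] := leqP `|i| (k + N); first by have := id i (LpP i _); lia.
  have := id (k + N)%N (LpP (k + N)%N _); have := id (- (k + N)%N%:Z) (LpP (- (k + N)%N%:Z) _); lia.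
by move=> lk; split; [exact: xx'|exact: yy'].
Qed.

End variation.

(** * Approximation and exchanges in measure *)

Section mass.
Context d (T : measurableType d) (R : realType) (mu : probability T R).
Implicit Types (E F : set T).

(** Real values make linear arithmetic available. *)
Definition mass E : R := fine (mu E).

Lemma massE E : measurable E -> mu E = (mass E)%:E.
Proof. by move=> mE; rewrite /mass fineK// fin_num_measure. Qed.

Lemma mass_eq0 E : measurable E -> mu E = 0%E <-> mass E = 0.
Proof.
by move=> mE; rewrite massE//; split=> [[]//|->].
Qed.

Lemma mass_ge0 E : 0 <= mass E.
Proof. exact/fine_ge0/measure_ge0. Qed.

Lemma mass_le E F : measurable E -> measurable F -> E `<=` F -> mass E <= mass F.
Proof. by move=> mE mF EF; rewrite -lee_fin -!massE// le_measure ?inE. Qed.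

Lemma massU_le E F : measurable E -> measurable F ->
  mass (E `|` F) <= mass E + mass F.
Proof.
move=> mE mF; rewrite -lee_fin EFinD -!massE//; first exact: measureU2.
exact: measurableU.
Qed.

Lemma massDI E F : measurable E -> measurable F ->
  mass E = mass (E `\` F) + mass (E `&` F).
Proof.
move=> mE mF.
have mD : measurable (E `\` F) by exact: measurableD.
have mI : measurable (E `&` F) by exact: measurableI.
by apply/EFin_inj; rewrite EFinD -!massE//; exact: measureDI.
Qed.

Lemma massT : mass setT = 1.
Proof. by rewrite /mass probability_setT. Qed.

Lemma mass0 : mass set0 = 0.
Proof. by rewrite /mass measure0. Qed.

Lemma mass_sub (I : eqType) (s : seq I) (F : I -> set T) E :
  (forall i, measurable (F i)) -> measurable E ->
  (forall x, E x -> exists2 i, i \in s & F i x) ->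
  mass E <= \sum_(i <- s) mass (F i).
Proof.
move=> mF; elim: s E => [|i s IHs] E mE EF.
  have -> : E = set0 by apply/seteqP; split => // x /EF[].
  by rewrite big_nil mass0.
rewrite big_cons; have mD : measurable (E `\` F i) by exact: measurableD.
apply: (@le_trans _ _ (mass (F i) + mass (E `\` F i))).
  apply: le_trans (massU_le (mF i) mD); apply: mass_le => //.
    exact: measurableU.
  by move=> x Ex; have [|] := pselect (F i x); [left|right].
rewrite lerD2l; apply: IHs => // x [/EF[j]].
by rewrite inE => /predU1P[->//|sj] Fj _; exists j.
Qed.

Lemma mass_bigcup (F : nat -> set T) (e : R) : (forall k, measurable (F k)) ->
  nondecreasing_seq F -> 0 < e -> exists k, mass (\bigcup_k F k `\` F k) < e.
Proof.
move=> mF ndF e0; have mU : measurable (\bigcup_k F k) by exact: bigcupT_measurable.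
have : mu (F k) @[k --> \oo] --> (mass (\bigcup_k F k))%:E.
  by rewrite -massE//; exact: nondecreasing_cvg_mu.
move=> /fine_cvgP[_ /cvgrPdist_lt/(_ _ e0)[N _ /(_ N (leqnn N))]] /=.
move=> h; exists N; apply: le_lt_trans h.
have := massDI mU (mF N).
have -> : (\bigcup_k F k) `&` F N = F N by apply/setIidPr => x Fx; exists N.
by move=> ->; rewrite -/(mass (F N)) addrK ler_norm.
Qed.

Lemma null_bigcup (I : countType) (F : I -> set T) :
  (forall i, measurable (F i)) -> (forall i, mass (F i) = 0) ->
  mass (\bigcup_i F i) = 0.
Proof.
move=> mF F0; have mU : measurable (\bigcup_i F i).
  exact: countable_bigcupT_measurable.
apply/mass_eq0 => //; apply/(negligibleP mu mU).
pose G k := if unpickle k is Some i then F i else set0.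
have -> : \bigcup_i F i = \bigcup_k G k.
  apply/seteqP; split => x [i _ Fi]; first by exists (pickle i) => //; rewrite /G pickleK.
  by move: Fi; rewrite /G; case: unpickle => // j Fj; exists j.
apply: negligible_bigcup => k; rewrite /G; case: unpickle => [i|].
  by apply/negligibleP => //; apply/mass_eq0.
exact: negligible_set0.
Qed.

Local Open Scope charge_scope.

Lemma Radon_Nikodym_ge (nu : probability T R) E (c : R) :
  charge_of_finite_measure nu `<< mu -> measurable E -> 0 <= c ->
  (forall x, E x -> (c%:E <= ('d (charge_of_finite_measure nu) '/d mu) x)%E) ->
  c * mass E <= fine (nu E).
Proof.
move=> numu mE c0 cE.
rewrite -lee_fin EFinM -massE// fineK ?fin_num_measure//.
have -> : nu E = (\int[mu]_(x in E) ('d (charge_of_finite_measure nu) '/d mu) x)%E.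
  exact: Radon_Nikodym_integral numu mE.
rewrite -integral_cst//; apply: ge0_le_integral => //.
have mf := measurable_int _ (Radon_Nikodym_integrable numu).
exact: measurable_funS measurableT (@subsetT _ _) mf.
Qed.

End mass.

Section approximation.
Context n (A : 'M[nat]_n) (A0 : sft A !=set0) (R : realType).
Local Notation X := (SFT A0).
Context (mu : probability X R).
Local Notation m := (mass mu).

Let approx (E : set X) := measurable E /\ forall e : R, 0 < e ->
  exists k C, determined k C /\ m (E `\` C) + m (C `\` E) < e.

Let mdet k (C : set X) : determined k C -> measurable C.
Proof. exact: determined_measurable. Qed.

Let approxU E F : approx E -> approx F -> approx (E `|` F).
Proof.
move=> [mE aE] [mF aF]; split; first exact: measurableU.
move=> e e0; have e2 : 0 < e / 2 by rewrite divr_gt0.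
have [i [C [dC Ce]]] := aE _ e2; have [j [D [dD De]]] := aF _ e2.
have mC := mdet dC; have mD := mdet dD.
exists (maxn i j), (C `|` D); split.
  by apply: determinedU; [apply: determinedW dC|apply: determinedW dD];
    rewrite ?leq_maxl ?leq_maxr.
have h (E1 F1 C1 D1 : set X) : measurable E1 -> measurable F1 -> measurable C1 -> measurable D1 ->
    m ((E1 `|` F1) `\` (C1 `|` D1)) <= m (E1 `\` C1) + m (F1 `\` D1).
  move=> *; apply: le_trans (massU_le _ _ _); [|exact: measurableD..].
  apply: mass_le; [by apply: measurableD; exact: measurableU| |].
    by apply: measurableU; exact: measurableD.
  by move=> x [[?|?] nCD]; [left|right]; split=> // ?; apply: nCD; [left|right].
have := h _ _ _ _ mE mF mC mD; have := h _ _ _ _ mC mD mE mF.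
by lra.
Qed.

Let approx_bigcup (F : nat -> set X) : (forall k, approx (F k)) ->
  nondecreasing_seq F -> approx (\bigcup_k F k).
Proof.
move=> aF ndF; have mF k : measurable (F k) by have [] := aF k.
have mU : measurable (\bigcup_k F k) by exact: bigcupT_measurable.
split=> // e e0; have e2 : 0 < e / 2 by rewrite divr_gt0.
have [N Ne] := mass_bigcup mu mF ndF e2.
have [_ /(_ _ e2)[k [C [dC Ce]]]] := aF N; have mC := mdet dC.
exists k, C; split=> //.
have h1 : m (\bigcup_k F k `\` C) <= m (\bigcup_k F k `\` F N) + m (F N `\` C).
  apply: le_trans (massU_le _ _ _); [|exact: measurableD..].
  apply: mass_le; [exact: measurableD|by apply: measurableU; exact: measurableD|].
  by move=> x [Ux nC]; have [?|?] := pselect (F N x); [right|left].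
have h2 : m (C `\` \bigcup_k F k) <= m (C `\` F N).
  apply: mass_le; [exact: measurableD..|].
  by move=> x [Cx nU]; split=> // FNx; apply: nU; exists N.
by lra.
Qed.

(** The approximable sets form a sigma-algebra: complements are symmetric, and countable unions are
    increasing limits of finite ones. It contains the open sets, which are increasing unions of
    clopen sets. *)
Lemma approx_determined (E : set X) (e : R) : measurable E -> 0 < e ->
  exists k C, determined k C /\ m (E `\` C) + m (C `\` E) < e.
Proof.
move=> mE; suff : approx E by move=> [_]; exact.
have dapprox k C : determined k C -> approx C.
  move=> dC; split=> [|e' e0]; first exact: mdet dC.
  by exists k, C; rewrite setDv mass0 addr0.
have : smallest (sigma_algebra setT) (@open X) `<=` approx; last by apply.
apply: smallest_sub; last first.
  move=> U oU; have [V [dV ndV] ->] := open_bigcup_determined oU.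
  by apply: approx_bigcup => // k; exact: dapprox (dV k).
split=> [|F [mF aF]|F aF].
- by apply: (dapprox 0%N) => x y.
- split=> [|e' /aF[k [C [dC Ce]]]]; first exact: measurableD.
  exists k, (~` C); split; first exact: determinedC.
  by rewrite !setTD !setDE !setCK setIC (setIC (~` C)) -!setDE addrC.
- have -> : \bigcup_k F k = \bigcup_k (\bigcup_(i in `I_k) F i).
    apply/seteqP; split => x [i _]; last by move=> [j _ Fj]; exists j.
    by move=> Fi; exists i.+1 => //; exists i => //=.
  apply: approx_bigcup.
    elim=> [|k IHk]; first by rewrite bigcup_mkord big_ord0; apply: (dapprox 0%N) => x y.
    rewrite bigcup_mkord big_ord_recr/= -bigcup_mkord.
    exact: approxU.
  move=> i j ij; apply/subsetPset => x [k /= ki Fk]; exists k => //=.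
  exact: leq_trans ij.
Qed.

End approximation.

Section gibbs_mass.
Local Open Scope charge_scope.
Context n (A : 'M[nat]_n) (A0 : sft A !=set0) (R : realType).
Local Notation X := (SFT A0).
Context (phi : X -> R) (mu : probability X R).
Hypothesis mu_gibbs : gibbs_measure phi mu.
Local Notation m := (mass mu).

Lemma swap_preimage_measurable a w w' (E : set X) : measurable E ->
  measurable (swap a w w' @^-1` E).
Proof. by move=> mE; rewrite -[X in measurable X]setTI; exact: swap_measurable. Qed.

Lemma saturation_gibbs (E : set X) : saturation (@gibbs_relation _ _ A0) E =
  \bigcup_(i : int * seq 'I_n * seq 'I_n) (swap i.1.1 i.1.2 i.2 @^-1` E).
Proof.
apply/seteqP; split => [y [x Ex /gibbs_swap[a [w [w' <-]]]]|y [[[a w] w'] _ /= Ey]].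
  by exists (a, w, w') => //=; rewrite swapK.
exists (swap a w w' y) => //; have := swap_gibbs a w w' (swap a w w' y).
by rewrite swapK.
Qed.

Lemma saturation_gibbs_measurable (E : set X) : measurable E ->
  measurable (saturation (@gibbs_relation _ _ A0) E).
Proof.
move=> mE; rewrite saturation_gibbs; apply: countable_bigcupT_measurable => // i.
exact: swap_preimage_measurable.
Qed.

Lemma swap_preimage_null a w w' (E : set X) : measurable E -> m E = 0 ->
  m (swap a w w' @^-1` E) = 0.
Proof.
move=> mE /mass_eq0 E0; have [qi _] := mu_gibbs.
have mR := saturation_gibbs_measurable mE.
have /mass_eq0 R0 := qi _ mE (E0 mE).
apply/eqP; rewrite eq_le mass_ge0 andbT -(R0 mR); apply: mass_le => //.
  exact: swap_preimage_measurable.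
by rewrite saturation_gibbs => x Ex; exists (a, w, w').
Qed.

(** The exchange is its own inverse, so it serves as both [W] and [V] in [is_radon_nikodym]. Its
    density is the exponential of the energy off a null set, and the lower bound [c] is integrated
    over [E]. *)
Lemma swap_energy a w w' (E : set X) (c : R) : measurable E -> 0 <= c ->
  (forall x, E x -> c <= expR (energy phi (swap a w w' x) x)) ->
  c * m E <= m (swap a w w' @^-1` E).
Proof.
move=> mE c0 cE; have [qi [rho [mrho rho0 _ rhoD] [N [mN N0] rhoE]]] := mu_gibbs.
pose W : {mfun X >-> X} := swap a w w'.
have WK : cancel W W by exact: swapK.
have WS x : gibbs_relation (x, W x) by exact: swap_gibbs.
have [Z [mZ Z0 ZP]] := rhoD W W WK WK WS.
set nu := charge_of_finite_measure (distribution mu W) in ZP.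
have numu : nu `<< mu.
  apply/null_content_dominatesP => F mF /(mass_eq0 mu mF) F0.
  by apply/(mass_eq0 mu _); [exact: swap_preimage_measurable|exact: swap_preimage_null].
have mEZ : measurable (E `\` (N `|` Z)) by apply: measurableD => //; exact: measurableU.
have mNZ : measurable (N `|` Z) by exact: measurableU.
(* Outside [Z] the density is [rho]; outside [N] the logarithm of [rho] is the energy. Both sets are
   null and can be removed from [E]. *)
have mE0 : m E = m (E `\` (N `|` Z)).
  rewrite (massDI mu mE mNZ) -[RHS]addr0; congr (_ + _).
  apply/eqP; rewrite eq_le mass_ge0 andbT.
  apply: (@le_trans _ _ (m (N `|` Z))); first by apply: mass_le => //; exact: measurableI.
  have := massU_le mu mN mZ; rewrite (proj1 (mass_eq0 mu mN) N0).
  by rewrite (proj1 (mass_eq0 mu mZ) Z0) addr0.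
have mWE := swap_preimage_measurable a w w' mE.
have mWEZ := swap_preimage_measurable a w w' mEZ.
rewrite mE0; apply: (@le_trans _ _ (m (swap a w w' @^-1` (E `\` (N `|` Z))))); last first.
  by apply: mass_le => // x [].
apply: (Radon_Nikodym_ge numu mEZ c0).
move=> x [Ex nNZ]; have nZ : ~ Z x by move=> ?; apply: nNZ; right.
have nN : ~ N x by move=> ?; apply: nNZ; left.
have <- : (rho (W x, x))%:E = ('d nu '/d mu) x.
  by apply: contrapT => h; apply: nZ; apply: ZP.
rewrite lee_fin; have WxS : gibbs_relation (W x, x) by have := WS (W x); rewrite WK.
apply: le_trans (cE x Ex) _.
have <- : ln (rho (W x, x)) = energy phi (swap a w w' x) x.
  by apply: rhoE WxS _ => -[].
by rewrite lnK// posrE; exact: rho0.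
Qed.

(** [D] is covered by [#|I|] pieces, and the [i]-th exchange maps the [i]-th piece into [D'],
    shrinking mass at most by the factor [c]. *)
Lemma finite_energy (I : finType) (W : I -> int * seq 'I_n * seq 'I_n)
    (D D' : set X) (c : R) :
  measurable D -> measurable D' -> 0 <= c ->
  (forall x, D x -> exists i, D' (swap (W i).1.1 (W i).1.2 (W i).2 x)) ->
  (forall i x, D x -> D' (swap (W i).1.1 (W i).1.2 (W i).2 x) ->
    c <= expR (energy phi (swap (W i).1.1 (W i).1.2 (W i).2 x) x)) ->
  c * m D <= #|I|%:R * m D'.
Proof.
move=> mD mD' c0 WD cD; pose F i := D `&` swap (W i).1.1 (W i).1.2 (W i).2 @^-1` D'.
have mF i : measurable (F i) by apply: measurableI => //; exact: swap_preimage_measurable.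
have FD i : c * m (F i) <= m D'.
  apply: le_trans (swap_energy (mF i) c0 _) _; first by move=> x [Dx D'x]; exact: (cD i).
  apply: mass_le => //; first exact: swap_preimage_measurable.
  by move=> x [_] /=; rewrite swapK.
have DF : m D <= \sum_(i <- enum I) m (F i).
  apply: mass_sub => // x Dx; have [i Di] := WD x Dx; exists i => //.
  by rewrite mem_enum.
apply: le_trans (ler_wpM2l c0 DF) _; rewrite mulr_sumr.
apply: le_trans (ler_sum _ (fun i _ => FD i)) _.
by rewrite big_const_seq count_predT iter_addr_0 -cardE mulr_natl.
Qed.

End gibbs_mass.

(** * Ergodicity under the Gibbs relation *)

Section gibbs_ergodicity.
Context n (A : 'M[nat]_n) (A0 : sft A !=set0) (R : realType).
Local Notation X := (SFT A0).
Context (A_irr : irreducible A) (A_aper : aperiodic A) (A01 : zero_one A).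
Context (phi : X -> R) (phi_cont : continuous phi) (phi_sv : summable_variation phi).
Context (mu : probability X R) (mu_gibbs : gibbs_measure phi mu).
Local Notation m := (mass mu).
Implicit Types (x y z : X).

Lemma word_cat a (m1 m2 : nat) x :
  word a (m1 + m2) x = word a m1 x ++ word (a + m1%:Z) m2 x.
Proof.
rewrite /word /mkseq iotaD map_cat; congr (_ ++ _).
rewrite add0n -[X in iota X]addn0 iotaDl -map_comp; apply: eq_map => i /=.
by rewrite PoszD addrA.
Qed.

(** The window [|l| < k] starts at [1 - k] and has [2 * k - 1] letters. *)
Lemma agree_word k x y : (0 < k)%N ->
  word (1 - k%:Z) (k + k.-1) x = word (1 - k%:Z) (k + k.-1) y <-> agree k x y.
Proof.
by move=> k0; rewrite eq_word0; split=> xy l lk; apply: xy; lia.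
Qed.

Lemma mass_partition (I : finType) (f : X -> I) (E : set X) : measurable E ->
  (forall i, measurable (f @^-1` [set i])) ->
  \sum_(i : I) m (E `&` f @^-1` [set i]) = m E.
Proof.
move=> mE mf.
have H (s : seq I) : uniq s -> measurable (f @^-1` [set` s]) /\
    \sum_(i <- s) m (E `&` f @^-1` [set i]) = m (E `&` f @^-1` [set` s]).
  elim: s => [|i s IHs]; first by rewrite set_nil preimage_set0 setI0 big_nil mass0.
  move=> /andP[si /IHs[ms IH]]; rewrite big_cons IH.
  have -> : [set` i :: s] = i |` [set` s].
    apply/seteqP; split => x /=; rewrite inE; first by move=> /predU1P[|]; [left|right].
    by move=> [->|xs]; rewrite ?eqxx// xs orbT.
  rewrite preimage_setU; split; first exact: measurableU.
  have mU : measurable (E `&` (f @^-1` [set i] `|` f @^-1` [set` s])).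
    by apply: measurableI => //; exact: measurableU.
  rewrite (massDI mu mU ms); congr (_ + _); congr (m _); apply/seteqP; split => x /=.
  - move=> [Ex xi]; do !split=> //; first by left.
    by rewrite xi; exact/negP.
  - by move=> [[Ex [//|//]]].
  - by move=> [Ex sx]; do !split=> //; right.
  - by move=> [[Ex _] sx].
have [_] := H _ (enum_uniq I); rewrite big_enum => ->; congr (m _).
by apply/seteqP; split => [x []//|x Ex]; split => //=; rewrite mem_enum.
Qed.

(** Specification on both sides puts the centre of [y] into [x]; the collar width [N] does not
    depend on [k]. *)
Lemma exchange_point : exists N : nat, forall k x y, (0 < k)%N -> exists z,
  agree k y z /\ forall l : int, (k + N <= `|l|)%N -> letter x l = letter z l.
Proof.
have [N N0 NP] := @specification _ _ A0 A_irr A_aper A01.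
exists N => k x y k0.
have [|z1 [z1x z1y]] := NP x y (- (k + N)%N%:Z) (1 - k%:Z); first by lia.
have [|z [zz1 zx]] := NP z1 x (k%:Z - 1) (k + N)%N%:Z; first by lia.
exists z; split => [l lk|l lkN].
  by rewrite zz1 ?z1y//; lia.
have [l0|l0] := leP 0 l; first by rewrite zx//; lia.
by rewrite zz1 ?z1x//; lia.
Qed.

(* For invariant [B] this is the quasi-independence of [B] from the cylinder of
   [y]: summing over the cylinders of [x] gives [m B * m Cy <= kappa * m (Cy `&` B)]. *)
Lemma cylinder_comparison : exists2 kappa : R, 0 < kappa &
  forall k x y (B : set X), (0 < k)%N -> measurable B ->
    (forall a w w' z, B z -> B (swap a w w' z)) ->
    m (agree k x `&` B) * m (agree k y) <= kappa * m (agree k y `&` B) * m (agree k x).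
Proof.
have [N NP] := exchange_point.
have [C CP] := energy_exchange phi_cont phi_sv.
pose c0 : R := expR (- (C * N.+1%:R)).
(* An index records the left and right collar words before and after an exchange of central words.
   Their number is independent of [k]. *)
pose I : finType := ((N.-tuple 'I_n * N.-tuple 'I_n) * (N.-tuple 'I_n * N.-tuple 'I_n))%type.
pose t0 := [tuple of word 0 N (point : X)].
have Q0 : 0 < #|I|%:R :> R by rewrite ltr0n; apply/card_gt0P; exists ((t0, t0), (t0, t0)).
have c0_gt0 : 0 < c0 by exact: expR_gt0.
exists (#|I|%:R ^+ 2 / c0) => [|k x y B k0 mB Binv]; first by rewrite divr_gt0// exprn_gt0.
set Q : R := #|I|%:R in Q0 *.
pose v z := word (1 - k%:Z) (k + k.-1) z.
pose W z1 z2 (i : I) : int * seq 'I_n * seq 'I_n :=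
  (1 - (k + N)%N%:Z, (tval i.1.1 ++ v z1) ++ tval i.1.2,
  (tval i.2.1 ++ v z2) ++ tval i.2.2).
pose s z1 z2 i (z : X) : X := swap (W z1 z2 i).1.1 (W z1 z2 i).1.2 (W z1 z2 i).2 z.
have s_out z1 z2 i z l : (k + N <= `|l|)%N -> letter z l = letter (s z1 z2 i z) l.
  move=> lk; rewrite /s swap_out//= !size_cat !size_tuple ?size_mkseq.
  by clear -lk k0; lia.
have sP z1 z2 z : agree k z1 z -> exists i, agree k z2 (s z1 z2 i z).
  move=> z1z; have [z' [z2z' zz']] := NP k z z2 k0.
  pose p1 := [tuple of word (1 - (k + N)%N%:Z) N z].
  pose q1 := [tuple of word k%:Z N z].
  pose p2 := [tuple of word (1 - (k + N)%N%:Z) N z'].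
  pose q2 := [tuple of word k%:Z N z'].
  exists ((p1, q1), (p2, q2)); suff -> : s z1 z2 ((p1, q1), (p2, q2)) z = z' by [].
  have E z3 z4 : agree k z3 z4 -> (word (1 - (k + N)%N%:Z) N z4 ++ v z3) ++ word k%:Z N z4 =
      word (1 - (k + N)%N%:Z) (N + (k + k.-1) + N) z4.
    move=> z34; rewrite (word_cat _ (N + (k + k.-1)) N) (word_cat _ N (k + k.-1)).
    have -> : 1 - (k + N)%N%:Z + N%:Z = 1 - k%:Z by lia.
    have -> : 1 - (k + N)%N%:Z + (N + (k + k.-1))%N%:Z = k%:Z by lia.
    by rewrite /v (proj2 (agree_word z3 z4 k0)).
  rewrite /s /W /= (E _ _ z1z) (E _ _ z2z'); apply: swapE => l lk.
  by apply: zz'; clear -lk k0; lia.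
have mcyl z : measurable (agree k z).
  by apply: (@determined_measurable _ _ _ k) => z1 z2 z12 zz1 l lk; rewrite zz1// z12.
have mcylB z : measurable (agree k z `&` B) by exact: measurableI.
(* Fix one move of [z] from the cylinder of [y] to that of [x]. By [energy_exchange] its energy
   nearly cancels that of every move in the opposite direction, so [finite_energy] applies to all
   those moves with one constant. *)
have step1 z j : agree k y z -> agree k x (s y x j z) ->
    c0 * m (agree k x `&` B) <= Q * m (agree k y `&` B) * expR (energy phi (s y x j z) z).
  move=> yz xsz; rewrite -ler_pdivrMr ?expR_gt0// mulrAC -expRN.
  apply: (finite_energy mu_gibbs (W := W x y)) => //.
  - by rewrite mulr_ge0 ?expR_ge0.
  - by move=> z' [xz' Bz']; have [i yi] := sP x y z' xz'; exists i; split=> //; exact: Binv.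
  - move=> i z' [xz' _] [ysz' _]; rewrite -expRD ler_expR.
    have := CP k N z' (s x y i z') z (s y x j z) (s_out x y i z') (s_out y x j z).
    move=> /(_ _ _)/ler_normlP[].
    + by move=> l lk; rewrite -xz'// xsz.
    + by move=> l lk; rewrite -yz// ysz'.
    by rewrite /s => + _; lra.
have [z' [xz' yz']] := NP k y x k0.
have [j xj] : exists j, agree k x (s y x j y) by apply: sP.
have := mass_ge0 mu (agree k y `&` B); rewrite le_eqVlt => /predU1P[P0|P0].
  have : m (agree k x `&` B) <= 0.
    have := step1 y j (fun _ _ => erefl) xj; rewrite -P0 mulr0 mul0r.
    by rewrite pmulr_rle0.
  move=> Cx0; have -> : m (agree k x `&` B) = 0.
    by apply/eqP; rewrite eq_le Cx0 mass_ge0.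
  by rewrite -P0 mulr0 !mul0r.
(* Read backwards, [step1] says that every move from the cylinder of [y] to that of [x] has
   exponential energy at least [a], so [finite_energy] applies a second time. The case of a
   vanishing denominator was treated above. *)
pose a := c0 * m (agree k x `&` B) / (Q * m (agree k y `&` B)).
have : a * m (agree k y) <= Q * m (agree k x).
  apply: (finite_energy mu_gibbs (W := W y x)) => //.
  - by rewrite divr_ge0 ?mulr_ge0 ?mass_ge0 ?(ltW c0_gt0) ?(ltW Q0).
  - exact: sP.
  - move=> i z yz xsz; rewrite ler_pdivrMr ?mulr_gt0// [leRHS]mulrC; exact: step1.
rewrite /a mulrAC ler_pdivrMr ?mulr_gt0// => h.
rewrite -(ler_pM2l c0_gt0) mulrA; apply: le_trans h _.
rewrite le_eqVlt; apply/orP; left; apply/eqP; rewrite -/Q.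
by field; rewrite gt_eqF.
Qed.

Lemma gibbs_zero_one (B : set X) : measurable B ->
  (forall a w w' z, B z -> B (swap a w w' z)) -> m B = 0 \/ m (~` B) = 0.
Proof.
move=> mB Binv; have [kappa kappa0 cmp] := cylinder_comparison.
have quasi k (C : set X) : determined k C -> m B * m C <= kappa * m (C `&` B).
  move=> dC; wlog k0 : k dC / (0 < k)%N.
    by move=> h; apply: (h k.+1) => //; exact: determinedW dC.
  have mC := determined_measurable dC.
  pose M := (k + k.-1)%N.
  pose f z : M.-tuple 'I_n := [tuple of word (1 - k%:Z) M z].
  have fP z : f @^-1` [set f z] = agree k z.
    apply/seteqP; split => z1 /=; rewrite -agree_word//.
      by move=> /(congr1 val) /= <-.
    by move=> zz1; apply: val_inj => /=; rewrite -zz1.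
  have dcyl z : determined k (agree k z).
    by move=> z1 z2 z12 zz1 l lk; rewrite zz1// z12.
  have mf t : measurable (f @^-1` [set t]).
    have [[z <-]|not] := pselect (exists z, f z = t).
      by rewrite fP; exact: determined_measurable (dcyl z).
    suff -> : f @^-1` [set t] = set0 by exact: measurable0.
    by apply/seteqP; split => // z ft; apply: not; exists z.
  have cyl_quasi y : m B * m (agree k y) <= kappa * m (agree k y `&` B).
    rewrite -(mass_partition mB mf) mulr_suml.
    have -> : kappa * m (agree k y `&` B) =
        \sum_(t : M.-tuple 'I_n) kappa * m (agree k y `&` B) * m (setT `&` f @^-1` [set t]).
      by rewrite -mulr_sumr mass_partition// massT mulr1.
    apply: ler_sum => t _; rewrite setTI.
    have [[z <-]|not] := pselect (exists z, f z = t).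
      by rewrite fP setIC; exact: cmp.
    have -> : f @^-1` [set t] = set0.
      by apply/seteqP; split => // z ft; apply: not; exists z.
    by rewrite setI0 mass0 mul0r mulr0.
  rewrite -(mass_partition mC mf) -(mass_partition (measurableI _ _ mC mB) mf) !mulr_sumr.
  apply: ler_sum => t _.
  (* [C] is a union of full cylinders, so each nonempty piece of it is one. *)
  have [[z [Cz <-]]|not] := pselect (exists z, C z /\ f z = t).
    have Cc : C `&` agree k z = agree k z by apply/setIidPr => z1 zz1; exact: dC Cz.
    by rewrite fP Cc setIAC Cc.
  have -> : C `&` f @^-1` [set t] = set0.
    by apply/seteqP; split => // z [Cz ft]; apply: not; exists z.
  by rewrite mass0 mulr0 mulr_ge0 ?mass_ge0 ?ltW.
have mnB : measurable (~` B) by exact: measurableC.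
have small (e : R) : 0 < e -> m B * m (~` B) <= (kappa + 1) * e.
  move=> e0; have [k [C [dC Ce]]] := approx_determined mu mnB e0.
  have mC := determined_measurable dC; have CB := quasi _ _ dC.
  have h1 : m (C `&` B) <= e.
    apply: le_trans (ltW Ce); rewrite !setDE setCK lerDr; exact: mass_ge0.
  have h2 : m (~` B) <= m C + e.
    have := massDI mu mnB mC => ->; rewrite addrC; apply: lerD.
      by apply: mass_le => //; exact: measurableI.
    by apply: le_trans (ltW Ce); rewrite lerDl mass_ge0.
  have B1 : m B <= 1 by rewrite -(massT mu); apply: mass_le.
  have B0 := mass_ge0 mu B; have := mass_ge0 mu C.
  have : kappa * m (C `&` B) <= kappa * e by rewrite ler_pM2l.
  by nra.
have [//|B0] := eqVneq (m B) 0; [by left|right].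
have Bp : 0 < m B by rewrite lt_def B0 mass_ge0.
apply/eqP; rewrite eq_le mass_ge0 andbT leNgt; apply/negP => nB.
(* With this [e] the bound is half of the positive product that it should dominate. *)
have e0 : 0 < m B * m (~` B) / (kappa + 1) / 2 by rewrite !divr_gt0 ?mulr_gt0 ?addr_gt0.
have := small _ e0; have k1 : 0 < kappa + 1 by rewrite addr_gt0.
have -> : (kappa + 1) * (m B * m (~` B) / (kappa + 1) / 2) = m B * m (~` B) / 2.
  by field; rewrite gt_eqF.
have : 0 < m B * m (~` B) by rewrite mulr_gt0.
by lra.
Qed.

End gibbs_ergodicity.

(** * The cocycle *)

Section groups.
Context (G : groupType).
Implicit Types (g h : G).

Lemma discrete_lim_eq (u : nat -> G) g (N : nat) :
  (forall i, (N <= i)%N -> u i = g) -> discrete_lim u = g.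
Proof.
move=> ug; have cvu h (M : nat) : (forall i, (M <= i)%N -> u i = h) ->
    u @ \oo --> (h : discrete_topology G).
  move=> uh; move=> P /principal_filterP Ph; exists M => // i /= Mi.
  by rewrite uh.
rewrite /discrete_lim; apply: xget_unique; first exact: cvu ug.
move=> h uh; have /uh[M _ Mh] : nbhs (h : discrete_topology G) [set h].
  exact/principal_filterP.
have := Mh (maxn M N) (leq_maxl _ _); rewrite /= ug ?leq_maxr//.
Qed.

(** Among the conjugates of [g] by powers of [h] two coincide; [r] is the difference of the
    exponents. *)
Lemma conj_finite_commute g h : finite_conjugacy_classes G ->
  exists2 r : nat, (0 < r)%N & commute (h ^+ r)%g g.
Proof.
move=> /(_ g)/finite_seqP[s sE].
pose f (i : nat) := (h ^+ i * g * (h ^+ i)^-1)%g.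
have fs i : f i \in s.
  by have : [set` s] (f i) by rewrite -sE; exists (h ^+ i)%g.
have nu : ~~ uniq [seq f i | i <- iota 0 (size s).+1].
  apply/negP => us; have := @uniq_leq_size _ _ s us.
  rewrite size_map size_iota ltnn => /(_ _)/notF; apply => _ /mapP[i _ ->]; exact: fs.
have /(uniqPn g)[i [j [ij]]] := nu; rewrite size_map size_iota => js.
have is' : (i < (size s).+1)%N by exact: ltn_trans js.
rewrite !(nth_map 0%N) ?size_iota// !nth_iota// !add0n => fij.
exists (j - i)%N; first by rewrite subn_gt0.
move: fij; rewrite -(subnKC (ltnW ij)) addKn /f expgnDr invgM !mulgA.
by move=> /mulIg; rewrite -!mulgA => /mulgI E; rewrite /commute {2}E !mulgA mulgVK.
Qed.

(** Whether [h * k] commutes with [g] depends on [h] only through the conjugate [h^-1 * g * h],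
    which takes finitely many values. *)
Lemma commute_transfer g h h1 k : commute (h1 * k)%g g ->
  (h1^-1 * g * h1 = h^-1 * g * h)%g -> commute (h * k)%g g.
Proof.
move=> c cj; have kg : (k * g = h1^-1 * g * h1 * k)%g.
  by apply: (@mulgI _ h1); rewrite !mulgA mulgV mul1g c mulgA.
by rewrite /commute -mulgA kg cj !mulgA mulgV mul1g.
Qed.

End groups.

(** One representative is chosen per state, and [T0] is the maximum of [T] over them. *)
Lemma finite_state (I : Type) (Y : choiceType) (st : I -> Y) (D : set I) (T : I -> nat) :
  finite_set (st @` D) -> exists T0, forall i, D i ->
  exists j, [/\ D j, st j = st i & (T j <= T0)%N].
Proof.
move=> /finite_seqP[s sE].
have /choice[rep repP] : forall y, exists i : option I,
    y \in s -> if i is Some j then D j /\ st j = y else False.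
  move=> y; have [ys|_] := boolP (y \in s); last by exists None.
  have : [set` s] y by [].
  by rewrite -sE => -[j Dj <-]; exists (Some j).
exists (\max_(y <- s) if rep y is Some j then T j else 0)%N => i Di.
have si : st i \in s by have : [set` s] (st i) by rewrite -sE; exists i.
have := repP _ si; have := @leq_bigmax_seq _ s xpredT
  (fun y => if rep y is Some j then T j else 0%N) _ si isT.
by case: (rep (st i)) => // j Tj [Dj stj]; exists j.
Qed.

Section cocycles.
Context n (A : 'M[nat]_n) (A0 : sft A !=set0) (G : groupType).
Local Notation X := (SFT A0).
Context (psi : X -> G).
Implicit Types (x y z : X) (a d l : int).

Definition seg x a (L : nat) : G := (\prod_(k < L) psi (sft_shift (a + k%:Z)%R x))%g.

Definition window_prod (K : nat) x : G := seg x (- K%:Z) (K + K.+1).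

Lemma seg_cat x a (L L' : nat) : seg x a (L + L') = (seg x a L * seg x (a + L%:Z)%R L')%g.
Proof.
rewrite /seg big_split_ord; congr (_ * _)%g.
by apply: eq_bigr => k _ /=; rewrite PoszD addrA.
Qed.

(** A continuous map to a discrete space is locally constant; compactness makes the window
    uniform. *)
Lemma psi_window : continuous (psi : _ -> discrete_topology G) ->
  exists2 w : nat, (0 < w)%N & forall x y, agree w x y -> psi x = psi y.
Proof.
move=> psi_cont.
have [||k kP] := @compact_bound _ _ A0 (fun k x => forall y, agree k x y -> psi x = psi y).
- by move=> i j x ij iP y xy; apply: iP; exact: agreeW xy.
- move=> x; have [k kP] : exists k, forall y, agree k x y -> psi y = psi x.
    have := @psi_cont x [set psi x]; move=> /(_ _)/nbhs_window; apply.
    exact/principal_filterP.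
  exists k => y xy z yz; rewrite (kP y xy) (kP z)// => l lk.
  by rewrite xy// yz.
by exists k.+1 => // x y xy; apply: kP; exact: agreeW xy.
Qed.

Context (w : nat) (w_gt0 : (0 < w)%N) (psiP : forall x y, agree w x y -> psi x = psi y).

Lemma seg_local x y a d (L : nat) :
  (forall l, a - w%:Z < l < a + L%:Z + w%:Z - 1 -> letter x l = letter y (l + d)) ->
  seg x a L = seg y (a + d) L.
Proof.
move=> xy; apply: eq_bigr => k _; apply: psiP => l lw.
rewrite !letter_shift xy; last by have := ltn_ord k; lia.
by congr letter; lia.
Qed.

Lemma seg_local0 x y a (L : nat) :
  (forall l, a - w%:Z < l < a + L%:Z + w%:Z - 1 -> letter x l = letter y l) ->
  seg x a L = seg y a L.
Proof.
by move=> xy; rewrite -[in RHS](addr0 a); apply: seg_local => l /xy; rewrite addr0.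
Qed.

(** Beyond [K] the factors for [x] and [y] coincide, so both limits are attained at [K]. The window
    product is the backward product times the forward one, and [fx * fy^-1 = bx^-1 * by_] means
    [bx * fx = by_ * fy]. *)
Lemma S_relation_window_prod x y (k K : nat) :
  (forall l, (k <= `|l|)%N -> letter x l = letter y l) -> (k + w <= K)%N ->
  S_relation psi (x, y) <-> window_prod K x = window_prod K y.
Proof.
move=> xy kK.
have fwdE i z : forward_prod psi i z = seg z 0 i.+1.
  by apply: eq_bigr => j _; rewrite add0r.
have bwdE i z : backward_prod psi i z = seg z (- i%:Z) i.
  by apply: eq_bigr => j _; rewrite addrC.
have fwd : J_plus psi x y = (forward_prod psi K x * (forward_prod psi K y)^-1)%g.
  apply: (@discrete_lim_eq _ _ _ K) => i Ki; rewrite !fwdE.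
  have -> : i.+1 = (K.+1 + (i - K))%N by lia.
  rewrite !seg_cat (@seg_local0 x y (0 + K.+1%:Z)) ?invgM ?mulgA ?mulgK// => l lK.
  by apply: xy; lia.
have bwd : J_minus psi x y = ((backward_prod psi K x)^-1 * backward_prod psi K y)%g.
  apply: (@discrete_lim_eq _ _ _ K) => i Ki; rewrite !bwdE.
  have E z : seg z (- i%:Z) i = (seg z (- i%:Z) (i - K) * seg z (- K%:Z) K)%g.
    rewrite -[X in seg z _ X = _](subnK Ki) seg_cat; congr (_ * seg _ _ _)%g; lia.
  rewrite !E (@seg_local0 x y (- i%:Z)) ?invgM ?mulgA ?mulgVK//.
  by move=> l lK; apply: xy; lia.
have window_prodE z : window_prod K z = (backward_prod psi K z * forward_prod psi K z)%g.
  by rewrite /window_prod seg_cat fwdE bwdE addNr.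
have xyR := window_gibbs xy.
rewrite /S_relation /= fwd bwd !window_prodE.
set bx := backward_prod psi K x; set by_ := backward_prod psi K y.
set fx := forward_prod psi K x; set fy := forward_prod psi K y.
split=> [[_ E]|E].
  apply: (@mulIg _ (fy^-1)%g); rewrite mulgK -mulgA E mulgA mulgV mul1g //.
split=> //; apply: (@mulgI _ bx); rewrite mulgA E mulgA mulgV mul1g -mulgA mulgV mulg1 //.
Qed.

Lemma S_relationE x y : S_relation psi (x, y) <-> exists k : nat,
  (forall l, (k <= `|l|)%N -> letter x l = letter y l) /\
  forall K, (k <= K)%N -> window_prod K x = window_prod K y.
Proof.
split=> [Sxy|[k [xy tot]]]; last first.
  by apply/(S_relation_window_prod xy (leqnn _))/tot; rewrite leq_addr.
have [/gibbs_window[k xy] _] := Sxy; exists (k + w)%N; split=> [l lk|K kK].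
  by apply: xy; lia.
exact/(S_relation_window_prod xy kK).
Qed.

Lemma S_relation_sym x y : S_relation psi (x, y) -> S_relation psi (y, x).
Proof.
move=> /S_relationE[k [xy tot]]; apply/S_relationE; exists k.
by split=> *; [rewrite xy|rewrite tot].
Qed.

Lemma S_relation_trans x y z :
  S_relation psi (x, y) -> S_relation psi (y, z) -> S_relation psi (x, z).
Proof.
move=> /S_relationE[k [xy xyT]] /S_relationE[j [yz yzT]]; apply/S_relationE.
exists (maxn k j); split=> [l|K]; rewrite geq_max => /andP[kl jl].
  by rewrite xy// yz.
by rewrite xyT// yzT.
Qed.

End cocycles.

(** * Return times *)

Section returns.
Context n (A : 'M[nat]_n) (A0 : sft A !=set0) (G : groupType).
Local Notation X := (SFT A0).
Context (A_irr : irreducible A) (A_aper : aperiodic A) (A01 : zero_one A).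
Context (G_fc : finite_conjugacy_classes G).
Context (psi : X -> G) (w : nat) (w_gt0 : (0 < w)%N)
  (psiP : forall x y, agree w x y -> psi x = psi y).
Context (b : int) (u u' : seq 'I_n) (x0 : X).
Implicit Types (x y z : X) (l : int) (t : nat).

Local Notation s := (size u).
Local Notation seg := (seg psi).

(** An exchange on [[b, b + s)] affects [psi] at positions less than [w] away, and these read
    letters less than [w] further out; hence the margin [2 * w]. *)
Definition in_window l := b - (w + w)%N%:Z <= l < b + (s + (w + w))%N%:Z.

Definition follows (d : int) x := forall l, in_window l -> letter x (l + d) = letter x0 l.

Definition twist : G :=
  (seg (swap b u u' x0) (b - w%:Z) (s + (w + w)) * (seg x0 (b - w%:Z) (s + (w + w)))^-1)%g.

Definition return_at (t : nat) x :=
  follows t%:Z x /\ commute (seg x (b - w%:Z) t) twist.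

(** The window is cut before and after the affected stretch. The outer products do not change, and
    the middle ones are translates of those of [x0]. *)
Lemma window_prod_swap (d : int) (K : nat) x : follows d x ->
  (`|b| + `|d| + s + w + w < K)%N ->
  let alpha := seg x (- K%:Z) `|(b + d - w%:Z + K%:Z)%R|%N in
  window_prod psi K (swap (b + d) u u' x) = (alpha * twist * alpha^-1 * window_prod psi K x)%g.
Proof.
move=> xd dK; cbv zeta.
set L1 := `|(b + d - w%:Z + K%:Z)%R|%N.
have L1E : L1%:Z = b + d - w%:Z + K%:Z by rewrite /L1; lia.
pose L2 := (K + K.+1 - (L1 + (s + (w + w))))%N.
have LE : (K + K.+1 = L1 + (s + (w + w)) + L2)%N by rewrite /L2; lia.
clearbody L1 L2; rewrite /window_prod LE !(seg_cat psi _ _ _ L2) !(seg_cat psi _ _ L1).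
have out l : ~~ (b + d <= l < b + d + s%:Z) ->
    letter (swap (b + d) u u' x) l = letter x l by exact: swap_out.
rewrite (@seg_local0 _ _ A0 G psi w w_gt0 psiP (swap (b + d) u u' x) x (- K%:Z)); last first.
  by move=> l lK; apply: out; lia.
rewrite (@seg_local0 _ _ A0 G psi w w_gt0 psiP (swap (b + d) u u' x) x
  (- K%:Z + (L1 + (s + (w + w)))%N%:Z)); last first.
  by move=> l lK; apply: out; lia.
have aE : - K%:Z + L1%:Z = b - w%:Z + d by lia.
have g1 : seg x (- K%:Z + L1%:Z) (s + (w + w)) = seg x0 (b - w%:Z) (s + (w + w)).
  rewrite aE; symmetry; apply: (seg_local w_gt0 psiP) => l lw; rewrite xd//.
  by rewrite /in_window; lia.
have g2 : seg (swap (b + d) u u' x) (- K%:Z + L1%:Z) (s + (w + w)) =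
    seg (swap b u u' x0) (b - w%:Z) (s + (w + w)).
  rewrite aE; symmetry; apply: (seg_local w_gt0 psiP) => l lw.
  have [lb|lNb] := boolP (b <= l < b + s%:Z).
    symmetry; apply: swap_local; last by lia.
    by move=> k kb; apply: xd; rewrite /in_window; lia.
  rewrite swap_out// out; last by lia.
  by rewrite xd// /in_window; lia.
by rewrite g1 g2 /twist !mulgA !mulgVK.
Qed.

(** If [beta] is the product over the time [t], the two exchanges conjugate [twist] by [alpha] and
    by [alpha * beta]. The results agree since [beta] commutes with [twist]. *)
Lemma return_S t x : follows 0 x -> return_at t x ->
  S_relation psi (swap b u u' x, swap (b + t%:Z) u u' x).
Proof.
move=> x_0 [x_t ct]; apply/(S_relationE w_gt0 psiP).
exists (`|b| + `|t| + s + w + w).+1; split=> [l lk|K kK].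
  by rewrite !swap_out//; lia.
have := window_prod_swap x_0 (K := K); rewrite addr0 => -> /=; last by lia.
rewrite (window_prod_swap x_t) /=; last by lia.
have -> : `|(b + t%:Z - w%:Z + K%:Z)%R|%N = (`|(b - w%:Z + K%:Z)%R| + t)%N by lia.
rewrite seg_cat; congr (_ * _)%g.
have -> : - K%:Z + `|(b - w%:Z + K%:Z)%R|%N%:Z = b - w%:Z by lia.
move: (twist) ct => g ct; rewrite invgM !mulgA; congr (_ * _)%g.
by rewrite -[in RHS](mulgA _ _ g) ct mulgA mulgK.
Qed.

Lemma seg_periodic x (a : int) (p i : nat) :
  (forall l, letter x (l + p%:Z) = letter x l) ->
  seg x a (p * i) = (seg x a p ^+ i)%g.
Proof.
move=> xp; elim: i => [|i IHi]; first by rewrite muln0 /seg big_ord0 expg0.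
rewrite mulnS seg_cat expgS -IHi; congr (_ * _)%g; symmetry.
by apply: (seg_local w_gt0 psiP) => l _; rewrite xp.
Qed.

(* Closing up [x] after time [t] gives a periodic point; a power of its loop
   commutes with [twist], as [twist] has finitely many conjugates. *)
Lemma return_exists t x : follows 0 x -> exists z (t' : nat),
  [/\ (t <= t')%N, return_at t' z &
      forall l, b - (w + w)%N%:Z <= l <= b + t%:Z -> letter z l = letter x l].
Proof.
move=> x_0; have [N N0 NP] := @specification _ _ A0 A_irr A_aper A01.
(* The block from [b - 2 * w] to [b + t1] is kept; after a gap of length [N] it starts again, so the
   period is [p]. *)
pose t1 := (t + s + (w + w))%N; pose p := (t1 + (w + w) + N)%N.
have [|y [yx ysx]] := NP x (sft_shift (- p%:Z) x) (b + t1%:Z) (b - (w + w)%N%:Z + p%:Z).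
  by rewrite /p; lia.
have p0 : (0 < p)%N by rewrite /p; lia.
have [|z [zy zp]] := @periodic_point _ _ A0 y (b - (w + w)%N%:Z) p p0.
  rewrite [RHS]ysx; last exact: lexx.
  by rewrite letter_shift addrK yx//; lia.
have zx l : b - (w + w)%N%:Z <= l <= b + t1%:Z -> letter z l = letter x l.
  by move=> lt; rewrite zy ?yx//; rewrite /p; lia.
have [r r0 rP] := conj_finite_commute twist (seg z (b - w%:Z) p) G_fc.
have zpi i l : letter z (l + (p * i)%N%:Z) = letter z l.
  elim: i l => [|i IHi] l; first by rewrite muln0 addr0.
  by rewrite mulnS PoszD addrA addrAC zp IHi.
(* The factor [r] gives commutation, the factor [t.+1] makes the time at least [t]. *)
exists z, (p * (r * t.+1))%N; split.
- by apply: leq_trans (leq_pmull _ p0); apply: leq_trans (leq_pmull _ r0).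
- split=> [l lw|].
    rewrite zpi zx; first by rewrite -(x_0 l lw) addr0.
    by move: lw; rewrite /in_window /t1; lia.
  by rewrite seg_periodic// expgnA; apply/commute_sym/commuteX/commute_sym.
- by move=> l lt; apply: zx; rewrite /t1; lia.
Qed.

(** Whether a continuation after [b + t] produces a return depends only on the last letters before
    it and on the conjugate of [twist] by the product so far. There are finitely many such states,
    so a continuation found for one representative of each can be transplanted to all points. *)
Lemma return_bounded : exists T : nat, forall x t, follows 0 x -> exists z (t' : nat),
  [/\ (t <= t' <= t + T)%N, return_at t' z &
      forall l, ~~ (b + t%:Z < l < b + t%:Z + T%:Z) -> letter z l = letter x l].
Proof.
have [N N0 NP] := @specification _ _ A0 A_irr A_aper A01.
pose W := (w + w).+1.
pose st (xt : X * nat) : W.-tuple 'I_n * G :=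
  ([tuple of word (b - (w + w)%N%:Z + xt.2%:Z) W xt.1],
   ((seg xt.1 (b - w%:Z) xt.2)^-1 * twist * seg xt.1 (b - w%:Z) xt.2)%g).
have /choice[ret retP] : forall xt : X * nat, exists zt : X * nat, follows 0 xt.1 ->
    [/\ (xt.2 <= zt.2)%N, return_at zt.2 zt.1 &
      forall l, b - (w + w)%N%:Z <= l <= b + xt.2%:Z -> letter zt.1 l = letter xt.1 l].
  move=> [x t]; have [x_0|] := pselect (follows 0 x); last by exists (x, t).
  by have [z [t' h]] := return_exists t x_0; exists (z, t').
have fin : finite_set (st @` [set xt | follows 0 xt.1]).
  apply: (@sub_finite_set _ _ ([set: W.-tuple 'I_n] `*`
      [set (h * twist * h^-1)%g | h in [set: G]])).
    move=> _ [[x t] /= _ <-]; split => //=.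
    by exists (seg x (b - w%:Z) t)^-1%g => //; rewrite invgK.
  apply: finite_setX; last exact: G_fc.
  exact: (@finite_finset (W.-tuple 'I_n)).
(* The bound covers the extra time, the window of the returned word, and the gap needed to rejoin
   [x]. *)
have [T0 T0P] := finite_state
  (fun xt : X * nat => ((ret xt).2 - xt.2 + s + (w + w) + N.+1)%N) fin.
exists T0 => x t x_0.
have [[x1 t1] [/= x1_0 stE T1]] := T0P (x, t) x_0.
move: (retP (x1, t1) x1_0) T1; case: (ret (x1, t1)) => z1 t1' /= [t1t1' [z1f z1c] z1x1] T1.
have [words conj] : (forall l, b - (w + w)%N%:Z + t%:Z <= l <= b + t%:Z ->
    letter x l = letter x1 (l + (t1%:Z - t%:Z))) /\
    ((seg x1 (b - w%:Z) t1)^-1 * twist * seg x1 (b - w%:Z) t1 =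
     (seg x (b - w%:Z) t)^-1 * twist * seg x (b - w%:Z) t)%g.
  have := congr1 snd stE; have /= wE := congr1 (fun p => tval p.1) stE.
  rewrite /= => cE; split=> // l lt; symmetry.
  have E : b - (w + w)%N%:Z + t1%:Z =
      b - (w + w)%N%:Z + t%:Z + (t1%:Z - t%:Z) by lia.
  move: wE; rewrite E => /eq_word; apply; rewrite /W; lia.
pose t' := (t + (t1' - t1))%N.
pose e := b + t'%:Z + (s + (w + w))%N%:Z.
(* [y] follows [x] up to [b + t] and then the translated continuation; [z] below rejoins [x] once
   the return is complete. *)
have [|y [yx yz1]] := @splice _ _ A0 x (sft_shift (t1%:Z - t%:Z) z1) (b + t%:Z).
  by rewrite letter_shift words ?z1x1//; lia.
have [|z [zy zx]] := NP y x e (e + N%:Z); first exact: lexx.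
have zz1 l : b - (w + w)%N%:Z + t%:Z <= l <= e -> letter z l = letter z1 (l + (t1%:Z - t%:Z)).
  move=> le; rewrite zy; last by lia.
  have [lt|lt] := leP l (b + t%:Z); last by rewrite yz1 ?letter_shift//; lia.
  rewrite yx// words; last by lia.
  by rewrite z1x1//; lia.
have zx' l : l <= b + t%:Z -> letter z l = letter x l.
  by move=> lt; rewrite zy ?yx// /e /t'; lia.
exists z, t'; split.
- by rewrite /t'; lia.
- split.
    move=> l lw; rewrite -z1f// zz1.
      by congr letter; rewrite /t'; lia.
    by move: lw; rewrite /in_window /e /t'; lia.
  have -> : seg z (b - w%:Z) t' =
      (seg x (b - w%:Z) t * seg z1 (b - w%:Z + t1%:Z) (t1' - t1))%g.
    rewrite /t' seg_cat; congr (_ * _)%g.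
      by apply: (seg_local0 w_gt0 psiP) => l lt; apply: zx'; lia.
    have -> : b - w%:Z + t1%:Z = b - w%:Z + t%:Z + (t1%:Z - t%:Z) by lia.
    by apply: (seg_local w_gt0 psiP) => l lt; apply: zz1; rewrite /e /t'; lia.
  have z1E : seg z1 (b - w%:Z) t1' =
      (seg x1 (b - w%:Z) t1 * seg z1 (b - w%:Z + t1%:Z) (t1' - t1))%g.
    rewrite -{1}(subnKC t1t1') seg_cat; congr (_ * _)%g.
    by apply: (seg_local0 w_gt0 psiP) => l lt; apply: z1x1; lia.
  by apply: commute_transfer conj; rewrite -z1E.
- move=> l lt; have [lbt|lbt] := leP l (b + t%:Z); first exact: zx'.
  by apply: zx; rewrite /e /t'; lia.
Qed.

End returns.

(** * Ergodicity under [S_relation] *)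

Section skew_ergodicity.
Context n (A : 'M[nat]_n) (A0 : sft A !=set0) (R : realType) (G : groupType).
Local Notation X := (SFT A0).
Context (A_irr : irreducible A) (A_aper : aperiodic A) (A01 : zero_one A).
Context (phi : X -> R) (phi_cont : continuous phi) (phi_sv : summable_variation phi).
Context (mu : probability X R) (mu_gibbs : gibbs_measure phi mu).
Context (G_fc : finite_conjugacy_classes G).
Context (psi : X -> G) (w : nat) (w_gt0 : (0 < w)%N)
  (psiP : forall x y, agree w x y -> psi x = psi y).
Local Notation m := (mass mu).
Implicit Types (x y z : X) (B : set X).

Lemma swap_energy_ge : exists C : R, forall a (v v' : seq 'I_n) x,
  expR (- (C * (size v).+1%:R)) <= expR (energy phi (swap a v v' x) x).
Proof.
have [C CP] := energy_window phi_cont phi_sv; exists C => a v v' x.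
rewrite ler_expR; have [|_] := CP a (size v) x (swap a v v' x).
  by move=> l lv; rewrite swap_out.
by move=> /ler_normlP[]; lra.
Qed.

(** Replace [B] by a nearby clopen [D], which a far exchange leaves invariant. A point leaving [B]
    then lies in [B \ D] or is sent into [D \ B], and the energy bound, uniform in [t], controls the
    latter preimage. *)
Lemma shifted_swap_small B (b : int) (u u' : seq 'I_n) (e : R) : measurable B -> 0 < e ->
  exists N : nat, forall t : nat, (N <= t)%N ->
  m (B `&` swap (b + t%:Z) u u' @^-1` (~` B)) < e.
Proof.
move=> mB e0; have [C CP] := swap_energy_ge.
pose c := expR (- (C * (size u).+1%:R)); have c0 : 0 < c by exact: expR_gt0.
have d0 : 0 < e / (1 + c^-1) by rewrite divr_gt0// addr_gt0// invr_gt0.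
have [k [D [dD De]]] := approx_determined mu mB d0.
have mD := determined_measurable dD.
exists (`|b| + k)%N => t bt.
have mDB : measurable (D `\` B) by exact: measurableD.
have mBD : measurable (B `\` D) by exact: measurableD.
have mW (E : set X) : measurable E -> measurable (swap (b + t%:Z) u u' @^-1` E).
  exact: swap_preimage_measurable.
have h1 : c * m (swap (b + t%:Z) u u' @^-1` (D `\` B)) <= m (D `\` B).
  have := swap_energy mu_gibbs (mW _ mDB) (ltW c0) (fun x _ => CP (b + t%:Z) u u' x).
  move=> /le_trans; apply.
  apply: mass_le => //; first by do 2 apply: swap_preimage_measurable.
  by move=> x /=; rewrite swapK.
have h2 : m (B `&` swap (b + t%:Z) u u' @^-1` (~` B)) <=
    m (B `\` D) + m (swap (b + t%:Z) u u' @^-1` (D `\` B)).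
  apply: le_trans (massU_le _ _ _) => //; last exact: mW.
  apply: mass_le.
  - by apply: measurableI => //; apply: mW; exact: measurableC.
  - by apply: measurableU => //; exact: mW.
  move=> x [Bx nBx]; have [Dx|nDx] := pselect (D x); last by left.
  right; split=> //; apply: dD Dx => l lk; rewrite swap_out//; lia.
apply: le_lt_trans h2 _.
have h3 : m (swap (b + t%:Z) u u' @^-1` (D `\` B)) <= c^-1 * m (D `\` B).
  by rewrite mulrC ler_pdivlMr// mulrC.
have c1 : 0 < c^-1 by rewrite invr_gt0.
move: De; rewrite ltr_pdivlMr ?addr_gt0// => De.
have := mass_ge0 mu (B `\` D); have := mass_ge0 mu (D `\` B).
by nra.
Qed.

Section returns.
Context (b : int) (u u' : seq 'I_n) (x0 : X).
Local Notation s := (size u).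
Local Notation follows := (follows w b u x0).
Local Notation return_at := (return_at psi w b u u' x0).

Lemma follows_local (t : nat) x y :
  (forall l : int, b - (w + w)%N%:Z <= l < b + (s + (w + w))%N%:Z + t%:Z ->
    letter x l = letter y l) ->
  follows t%:Z x -> follows t%:Z y.
Proof.
by move=> xy fx l lw; rewrite -xy ?fx//; move: lw; rewrite /in_window; lia.
Qed.

Lemma return_at_local (t : nat) x y :
  (forall l : int, b - (w + w)%N%:Z <= l < b + (s + (w + w))%N%:Z + t%:Z ->
    letter x l = letter y l) ->
  return_at t x -> return_at t y.
Proof.
move=> xy [fx cx]; split; first exact: follows_local fx.
rewrite -(@seg_local0 _ _ A0 G psi w w_gt0 psiP x)// => l lt.
by apply: xy; lia.
Qed.

Definition no_return (n0 M : nat) : set X := [set x | follows 0 x /\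
  forall t, (n0 <= t < n0 + M)%N -> ~ return_at t x].

Lemma no_return_local (n0 M : nat) x y :
  (forall l : int, b - (w + w)%N%:Z <= l < b + (s + (w + w) + n0 + M)%N%:Z ->
    letter x l = letter y l) ->
  no_return n0 M x -> no_return n0 M y.
Proof.
move=> xy [fx nx]; split.
  by apply: (@follows_local 0%N x) fx => l lt; apply: xy; lia.
move=> t tM ry; apply: (nx t tM); apply: return_at_local ry => l lt.
by rewrite xy//; lia.
Qed.

Lemma no_return_measurable (n0 M : nat) : measurable (no_return n0 M).
Proof.
apply: (@determined_measurable _ _ _ (`|b| + (s + (w + w) + n0 + M)).+1) => x y xy.
by apply: no_return_local => l lb; apply: xy; lia.
Qed.

(** By [return_bounded], each point without return up to [J * L] gets one in the next block by
    exchanging a word of length [T]. By [finite_energy] a fixed proportion of the points must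
    therefore return in that block. *)
Lemma no_return_decay : exists (q : R) (L : nat), [/\ 0 <= q, q < 1 &
  forall n0 J : nat, m (no_return n0 (J * L)) <= q ^+ J].
Proof.
have [T TP] := return_bounded A_irr A_aper A01 G_fc w_gt0 psiP b u u' x0.
have [C CP] := swap_energy_ge.
pose h := (s + (w + w))%N; pose L := (T + h).+1.
pose c := expR (- (C * T.+1%:R)); have c0 : 0 < c by exact: expR_gt0.
pose I : finType := (T.-tuple 'I_n * T.-tuple 'I_n)%type.
pose tp := [tuple of word 0 T (point : X)].
have Q0 : 0 < #|I|%:R :> R by rewrite ltr0n; apply/card_gt0P; exists (tp, tp).
pose kappa := c / #|I|%:R; have kappa0 : 0 < kappa by rewrite divr_gt0.
have step n0 J : m (no_return n0 (J.+1 * L)) <= (1 - kappa) * m (no_return n0 (J * L)).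
  set F := no_return n0 (J * L); set F' := no_return n0 (J.+1 * L).
  have mF : measurable F by exact: no_return_measurable.
  have mF' : measurable F' by exact: no_return_measurable.
  have mFF' : measurable (F `\` F') by exact: measurableD.
  (* The exchange starts at [b + t0], just past the coordinates on which [F] depends, so it stays in
     [F]; its return time is at most [t0 + T < n0 + J.+1 * L]. *)
  pose t0 := (n0 + J * L + h)%N.
  have fe : c * m F <= #|I|%:R * m (F `\` F').
    apply: (finite_energy mu_gibbs
      (W := fun i : I => (b + t0%:Z, tval i.1, tval i.2))) => //; first exact: ltW.
      move=> x Fx; have [z [t [tT rz zx]]] := TP x t0 Fx.1.
      exists ([tuple of word (b + t0%:Z) T x], [tuple of word (b + t0%:Z) T z]) => /=.
      rewrite swapE; last by move=> l lT; rewrite zx//; lia.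
      split; first by apply: no_return_local Fx => l lt; rewrite zx// /t0 /h; lia.
      by move=> [_ /(_ t)]; apply => //; move: tT; rewrite /t0 /L mulSn; lia.
    by move=> i x _ _ /=; have := CP (b + t0%:Z) i.1 i.2 x; rewrite size_tuple.
  have F'F : F `&` F' = F'.
    apply/setIidPr => x [fx nx]; split=> // t tJ; apply: nx; rewrite mulSn; lia.
  have := massDI mu mF mF'; rewrite F'F => FE.
  have : kappa * m F <= m (F `\` F') by rewrite /kappa mulrAC ler_pdivrMr// [leRHS]mulrC.
  by rewrite mulrBl mul1r; lra.
(* The maximum gives a nonnegative rate without comparing [kappa] to 1. *)
pose q := Num.max 0 (1 - kappa).
have q0 : 0 <= q by rewrite le_max lexx.
exists q, L; split=> //; first by rewrite gt_max ltr01/=; lra.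
move=> n0; elim=> [|J IHJ].
  by rewrite expr0 -(massT mu); apply: mass_le => //; exact: no_return_measurable.
apply: le_trans (step n0 J) _; rewrite exprS.
apply: (@le_trans _ _ (q * m (no_return n0 (J * L)))); last by rewrite ler_wpM2l.
by rewrite ler_wpM2r ?mass_ge0// le_max lexx orbT.
Qed.

End returns.

(* If [x] follows [x0] and returns at time [t], then swapping at [b] and swapping
   at [b + t] give [S_relation]-equivalent points, while the swap at [b + t]
   nearly preserves [B] for large [t]. *)
Lemma swap_invariant B : measurable B ->
  (forall x y, S_relation psi (x, y) -> B x -> B y) ->
  forall b u u', m (B `&` swap b u u' @^-1` (~` B)) = 0.
Proof.
move=> mB Binv b u u'; set D := B `&` _.
have mD : measurable D.
  by apply: measurableI => //; apply: swap_preimage_measurable; exact: measurableC.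
(* [D] is partitioned by the word on [in_window]; any point of a piece serves as its reference point
   [x0]. *)
pose M := (size u + (w + w) + (w + w))%N.
pose f z : M.-tuple 'I_n := [tuple of word (b - (w + w)%N%:Z) M z].
have fP x0 z : f z = f x0 <-> follows w b u x0 0 z.
  have -> : (f z = f x0) <->
      word (b - (w + w)%N%:Z) M z = word (b - (w + w)%N%:Z) M x0.
    by split=> [/(congr1 val)//|E]; exact: val_inj.
  rewrite eq_word0; split=> fz l lw.
    by rewrite addr0; apply: fz; move: lw; rewrite /in_window /M; lia.
  by rewrite -[l in LHS]addr0; apply: fz; move: lw; rewrite /in_window /M; lia.
have mf t : measurable (f @^-1` [set t]).
  apply: (@determined_measurable _ _ _ (`|b| + M + (w + w)).+1) => x y xy /= <-.
  by apply/esym/fP => l lw; rewrite addr0; apply: xy; move: lw; rewrite /in_window /M; lia.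
rewrite -(mass_partition mu mD mf); apply: big1 => t _.
have [[x0 [Dx0 ft]]|nex] := pselect (exists x, D x /\ f x = t); last first.
  rewrite (_ : D `&` _ = set0) ?mass0//; apply/seteqP; split=> // x [Dx fx].
  by apply: nex; exists x.
set E := D `&` _; have mE : measurable E by exact: measurableI.
have [q [L [q0 q1 qP]]] := no_return_decay b u u' x0.
apply/eqP; rewrite eq_le mass_ge0 andbT; apply/ler_addgt0Pr => e e0; rewrite add0r.
have e2 : 0 < e / 2 by rewrite divr_gt0.
have [J qJ] : exists J, q ^+ J < e / 2.
  have : q ^+ k @[k --> \oo] --> (0 : R) by apply: cvg_expr; rewrite ger0_norm.
  move=> /cvgrPdist_lt/(_ _ e2)[J _ /(_ J (leqnn J))] /=.
  by rewrite sub0r normrN ger0_norm ?exprn_ge0// => ?; exists J.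
(* The decay rate does not depend on [n0], so the number [JL] of candidate times is fixed before
   [n0] is taken large. Half of [e] is shared among these times. *)
pose JL := (J * L)%N.
have d0 : 0 < e / 2 / JL.+1%:R by rewrite divr_gt0.
have [n0 n0P] := shifted_swap_small b u u' mB d0.
have mN := no_return_measurable b u u' x0 n0 JL.
have mEN : measurable (E `\` no_return b u u' x0 n0 JL) by exact: measurableD.
have h1 : m (E `\` no_return b u u' x0 n0 JL) <=
    \sum_(t <- iota n0 JL) m (B `&` swap (b + t%:Z) u u' @^-1` (~` B)).
  apply: mass_sub => // [k|x [[[Bx nBx] fx] nN]].
    by apply: measurableI => //; apply: swap_preimage_measurable; exact: measurableC.
  have x_0 : follows w b u x0 0 x by apply/fP; rewrite fx.
  have [k kJ rk] : exists2 k, (n0 <= k < n0 + JL)%N & return_at psi w b u u' x0 k x.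
    apply: contrapT => nr; apply: nN; split=> // k kJ rk; apply: nr.
    by exists k.
  exists k; first by rewrite mem_iota.
  (* The swaps at [b] and [b + k] are [S_relation]-equivalent, so if the second stayed in [B], the
     first would too. *)
  split=> // Bk; apply: nBx; apply: Binv Bk; apply: (S_relation_sym w_gt0 psiP).
  exact: return_S x_0 rk.
have h2 : \sum_(t <- iota n0 JL) m (B `&` swap (b + t%:Z) u u' @^-1` (~` B)) <= e / 2.
  apply: (@le_trans _ _ (\sum_(t <- iota n0 JL) (e / 2 / JL.+1%:R))).
    rewrite [leLHS]big_seq [leRHS]big_seq; apply: ler_sum => k.
    by rewrite mem_iota => /andP[nk _]; exact/ltW/n0P.
  rewrite big_const_seq count_predT size_iota iter_addr_0 -[leLHS]mulr_natr [leLHS]mulrAC.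
  by rewrite ler_pdivrMr// ler_wpM2l ?(ltW e2)// ler_nat.
have := massDI mu mE mN.
have : m (E `&` no_return b u u' x0 n0 JL) <= m (no_return b u u' x0 n0 JL).
  by apply: mass_le => //; exact: measurableI.
by have := qP n0 J; rewrite -/JL; lra.
Qed.

Lemma saturation_S B : saturation (S_relation psi) B =
  \bigcup_(i : int * seq 'I_n * seq 'I_n) (swap i.1.1 i.1.2 i.2 @^-1`
    (B `&` [set x | S_relation psi (x, swap i.1.1 i.1.2 i.2 x)])).
Proof.
apply/seteqP; split => [y [x Bx Sxy]|y [[[a v] v'] _ /= [Bx]]].
  have [xyR _] := Sxy; have [a [v [v' xy]]] := gibbs_swap xyR.
  by exists (a, v, v') => //=; rewrite -xy swapK xy.
by rewrite swapK => Sxy; exists (swap a v v' y).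
Qed.

(** For a fixed exchange, whether [x] and its image are equivalent is decided by one window product,
    hence by finitely many coordinates. *)
Lemma saturation_S_measurable B : measurable B ->
  measurable (saturation (S_relation psi) B).
Proof.
move=> mB; rewrite saturation_S; apply: countable_bigcupT_measurable => // -[[a v] v'] /=.
apply: swap_preimage_measurable; apply: measurableI => //.
pose k := (`|a| + size v).+2; pose K := (k + w)%N.
have SK x : S_relation psi (x, swap a v v' x) <->
    window_prod psi K x = window_prod psi K (swap a v v' x).
  apply: (S_relation_window_prod w_gt0 psiP (k := k)) => // l lk.
  by rewrite swap_out//; lia.
apply: (@determined_measurable _ _ _ (K + w).+2) => x y xy /= /SK xS; apply/SK.
have W z z' : agree (K + w).+2 z z' -> window_prod psi K z = window_prod psi K z'.
  by move=> zz'; apply: (seg_local0 w_gt0 psiP) => l lK; apply: zz'; lia.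
rewrite -(W _ _ xy) xS; apply: W; apply: swap_agree => // l lv.
by rewrite /K /k; lia.
Qed.

(** Quasi-invariance passes to the smaller relation. The saturated set [E] is Gibbs invariant only
    up to null sets, so the zero-one law is applied to the Gibbs saturation [Z] of its complement,
    which meets [E] in a null set by [swap_invariant]. *)
Lemma S_ergodic : ergodic mu (S_relation psi).
Proof.
split=> [B mB /mass_eq0 B0|B mB]; set E := saturation _ B.
  have mE : measurable E by exact: saturation_S_measurable.
  have [qi _] := mu_gibbs; have mR := saturation_gibbs_measurable mB.
  have /mass_eq0 R0 := qi _ mB (proj2 (mass_eq0 mu mB) (B0 mB)).
  apply/mass_eq0 => //; apply/eqP; rewrite eq_le mass_ge0 andbT -(R0 mR).
  by apply: mass_le => // y [x Bx [xy _]]; exists x.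
have mE : measurable E by exact: saturation_S_measurable.
have Einv x y : S_relation psi (x, y) -> E x -> E y.
  by move=> xy [z Bz zx]; exists z => //; exact: (S_relation_trans w_gt0 psiP zx xy).
have mnE : measurable (~` E) by exact: measurableC.
pose Z := saturation (@gibbs_relation _ _ A0) (~` E).
have mZ : measurable Z by exact: saturation_gibbs_measurable.
have EZ : m (E `&` Z) = 0.
  rewrite /Z saturation_gibbs setI_bigcupr; apply: null_bigcup => i.
    by apply: measurableI => //; exact: swap_preimage_measurable.
  exact: swap_invariant.
have Zinv a v v' z : Z z -> Z (swap a v v' z).
  move=> [x nEx xz]; exists x => //.
  have [k xk] := gibbs_window xz; have [j zj] := gibbs_window (swap_gibbs a v v' z).
  apply: (@window_gibbs _ _ _ (k + j)) => l lk.
  by rewrite xk ?zj//; lia.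
have [Z0|Z0] := gibbs_zero_one A_irr A_aper A01 phi_cont phi_sv mu_gibbs mZ Zinv.
  right; apply/mass_eq0 => //; apply/eqP; rewrite eq_le mass_ge0 andbT -Z0.
  by apply: mass_le => // x nEx; exists x => //; exact: (@window_gibbs _ _ _ 0).
left; apply/mass_eq0 => //; apply/eqP; rewrite eq_le mass_ge0 andbT.
rewrite (massDI mu mE mZ) EZ addr0 -Z0.
apply: mass_le; [exact: measurableD|exact: measurableC|by move=> x []].
Qed.

End skew_ergodicity.

Theorem theorem3p3 (R : realType) (n : nat) (A : 'M[nat]_n)
    (n_gt0 : (0 < n)%N) (A01 : zero_one A) (A_irr : irreducible A)
    (A_aper : aperiodic A)
    (phi : SFT (sft_neq0 n_gt0 A01 A_irr) -> R)
    (phi_cont : continuous phi) (phi_sv : summable_variation phi)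
    (mu : probability (SFT (sft_neq0 n_gt0 A01 A_irr)) R)
    (mu_gibbs : gibbs_measure phi mu)
    (G : groupType) (G_count : countable [set: G])
    (G_fc : finite_conjugacy_classes G)
    (psi : SFT (sft_neq0 n_gt0 A01 A_irr) -> G)
    (psi_cont : continuous (psi : _ -> discrete_topology G)) :
  ergodic mu (S_relation psi).
Proof.
have [w w_gt0 psiP] := psi_window psi_cont.
exact: (S_ergodic A_irr A_aper A01 phi_cont phi_sv mu_gibbs G_fc w_gt0 psiP).
Qed.
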